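(* Let $q\in(0,1]$. Assume: [A2] $p$ is differentiable on $\mathbb R\setminus\{0\}$; [A5] there exists $\lambda>0$ with $\lim_{x\to0}p(x)/|x|^q=\lambda$; [A6] for every $j\in\mathcal J^{(0)}$, $(\xi_T^j)^{-1/q}|\alpha_T^j|^{-1}\to0$ in probability; [A10] (LAQ) there exist random vectors $\Delta_T,\Delta\in\mathbb R^{\mathsf p}$, random matrices $\Gamma_T,\Gamma\in\mathbb R^{\mathsf p\times\mathsf p}$ and random fields $r_T$ on $\mathbb U_T$ such that (i) $\mathbb H_T(\theta^*+a_Tu)-\mathbb H_T(\theta^* )=\Delta_T'u-\tfrac12u'\Gamma_Tu+r_T(u)$ for all $T\in\mathbb T$, $u\in\mathbb U_T$; (ii) $\Gamma$ is almost surely positive definite; (iii) $(\Delta_T,\Gamma_T)\to(\Delta,\Gamma)$ in distribution; (iv) for all $R>0$, $\sup_{|u|\le R,\,u\in\mathbb U_T}|r_T(u)|\to0$ in probability; [A11] for every $j\in\mathcal J^{(1)}$ there is a constant $\beta_j\in\mathbb R$ with $\xi_T^j\alpha_T^j\to\beta_j$ in probability. If $\tilde u_T=\tilde a_T^{-1}(\hat\theta_T-\theta^* )=O_p(1)$, then as $T\to\infty$ $$(\tilde a_T^{(00)})^{-1}(\hat\theta_T^{(0)}-\theta^{*(0)})\to0\ \text{in probability}$$ and $$(\tilde a_T^{(11)})^{-1}(\hat\theta_T^{(1)}-\theta^{*(1)})\to(\Gamma^{(11)})^{-1}(\Delta^{(1)}-\psi^{(1)})\ \text{in distribution},$$ where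 $\psi^{(1)}=(\beta_jp'(\theta^*_j))_{j\in\mathcal J^{(1)}}$.
   Context: Let $\Theta\subset\mathbb R^{\mathsf p}$ be a bounded open set with closure $\overline\Theta$ and $\theta^*\in\Theta$. Let $(\Omega,\mathcal F,P)$ be a probability space, $\mathbb T\subset\mathbb R_{\ge0}$ with $\sup\mathbb T=\infty$; limits $T\to\infty$ are along $\mathbb T$. For each $T\in\mathbb T$, $\mathbb H_T:\Omega\times\overline\Theta\to\mathbb R$ is a random field continuous in $\theta$ for every $\omega$. The penalty is $p_T(\theta)=\sum_{j=1}^{\mathsf p}\xi_T^jp(\theta_j)$ with (possibly random) $\xi_T^j>0$ and $p:\mathbb R\to\mathbb R_{\ge0}$, $p(0)=0$; $\mathbb H^\dagger_T=\mathbb H_T-p_T$, and $\hat\theta_T:\Omega\to\overline\Theta$ is measurable with $\mathbb H^\dagger_T(\hat\theta_T)=\max_{\overline\Theta}\mathbb H^\dagger_T$. $\mathcal J^{(0)}=\{j:\theta^*_j=0\}$, $\mathcal J^{(1)}=\{j:\theta^*_j\ne0\}$; for $x\in\mathbb R^{\mathsf p}$, $x^{(k)}=(x_j)_{j\in\mathcal J^{(k)}}$, and for a matrix $A$, $A^{(kl)}=(A_{ij})_{i\in\mathcal J^{(k)},j\in\mathcal J^{(l)}}$. $a_T=\mathrm{diag}(\alpha_T^1,\dots,\alpha_T^{\mathsf p})$ is deterministic, invertible, with $\|a_T\|\to0$ ($\|\cdot\|$ spectral norm); $\mathbb U_T=\{u:\theta^*+a_Tu\in\overline\Theta\}$. $\tilde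 a_T$ is diagonal with $(\tilde a_T)_{jj}=(\xi_T^j)^{-1/q}$ for $j\in\mathcal J^{(0)}$ and $\alpha_T^j$ for $j\in\mathcal J^{(1)}$. $X_T=O_p(1)$ means tightness. *)

(* Defs.v *)
From HB Require Import structures.
From mathcomp Require Import all_boot all_order all_algebra.
From mathcomp Require Import all_classical all_reals all_analysis.
Set Implicit Arguments. Unset Strict Implicit. Unset Printing Implicit Defensive.
Import Order.TTheory GRing.Theory Num.Theory.
Import numFieldNormedType.Exports.
Local Open Scope classical_set_scope.
Local Open Scope ring_scope.

Section Defs.
Context {R : realType}.

Definition lim_along (TT : set R) (f : R -> R) (l : R) : Prop :=
  forall e : R, 0 < e -> exists T0 : R, forall T, TT T -> T0 <= T -> `|f T - l| < e.

Definition enorm {n : nat} (u : 'rV[R]_n) : R := Num.sqrt (\sum_j u 0 j ^+ 2).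

Definition enorm_on {n : nat} (J : {set 'I_n}) (u : 'rV[R]_n) : R :=
  Num.sqrt (\sum_(j in J) u 0 j ^+ 2).

Definition subrowJ {n : nat} (J : {set 'I_n}) (u : 'rV[R]_n) : 'rV[R]_#|J| :=
  \row_(i < #|J|) u 0 (enum_val i).
Definition prinsubmx {n : nat} (J : {set 'I_n}) (A : 'M[R]_n) : 'M[R]_#|J| :=
  \matrix_(i < #|J|, k < #|J|) A (enum_val i) (enum_val k).

Definition posdef {n : nat} (A : 'M[R]_n) : Prop :=
  A^T = A /\ forall v : 'rV[R]_n, v != 0 -> 0 < (v *m A *m v^T) 0 0.

Context {d : measure_display} {Omega : measurableType d}.

Definition cvg_prob (P : probability Omega R) (TT : set R)
  (X : R -> Omega -> R) (Y : Omega -> R) : Prop :=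
  forall e : R, 0 < e ->
    lim_along TT (fun T => fine (P [set w | e < `|X T w - Y w|])) 0.

Definition cvg_dist (P : probability Omega R) (TT : set R) {V : topologicalType}
  (X : R -> Omega -> V) (Y : Omega -> V) : Prop :=
  forall f : V -> R, continuous f -> (exists M : R, forall v, `|f v| <= M) ->
    lim_along TT (fun T => fine (\int[P]_w (f (X T w))%:E))
                 (fine (\int[P]_w (f (Y w))%:E)).

Definition tight (P : probability Omega R) (TT : set R) {n : nat}
  (X : R -> Omega -> 'rV[R]_n) : Prop :=
  forall e : R, 0 < e -> exists M : R, forall T, TT T ->
    (P [set w | (M < enorm (X T w))%R] < e%:E)%E.

End Defs.

Section Defs2.
Context {R : realType}.

(* diagonal entries of tilde a_T *)
Definition atilde {Omega : Type} {n : nat} (thstar : 'rV[R]_n) (q : R)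
  (xi : R -> Omega -> 'I_n -> R) (alpha : R -> 'I_n -> R) (T : R) (w : Omega)
  (j : 'I_n) : R :=
  if thstar 0 j == 0 then powR (xi T w j) (- q^-1) else alpha T j.

Definition utilde {Omega : Type} {n : nat} (thstar : 'rV[R]_n) (q : R)
  (xi : R -> Omega -> 'I_n -> R) (alpha : R -> 'I_n -> R)
  (thhat : R -> Omega -> 'rV[R]_n) (T : R) (w : Omega) : 'rV[R]_n :=
  \row_j ((thhat T w 0 j - thstar 0 j) / atilde thstar q xi alpha T w j).

Definition penT {Omega : Type} {n : nat} (xi : R -> Omega -> 'I_n -> R)
  (pen : R -> R) (T : R) (w : Omega) (th : 'rV[R]_n) : R :=
  \sum_j xi T w j * pen (th 0 j).

End Defs2.

(* Main.v *)
Require Import Defs.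
From HB Require Import structures.
From mathcomp Require Import all_boot all_order all_algebra.
From mathcomp Require Import all_classical all_reals all_analysis.
From mathcomp Require Import measurable_realfun.
From mathcomp Require Import ring lra.
Import Order.TTheory GRing.Theory Num.Theory.
Import numFieldNormedType.Exports.
Local Open Scope classical_set_scope.
Local Open Scope ring_scope.

(** Everything is compared at a fixed [T] and [w] on a good event of probability
close to 1, where the rescaled estimator, [Delta_T] and [Gamma_T] are bounded by
[K] while the remainder, the rates and the errors in [A6], [A11] are at most a
small [e]. Maximality of the penalized criterion against [thhat] with its null
coordinates set to zero bounds the penalty paid on these coordinates by [O(e)];
by [A5] this forces the null part of [utilde] to be small. Maximality against
the maximizer [h(Delta_T, Gamma_T)] of the limiting quadratic form forces the
nonnull part of [utilde] to be close to [h(Delta_T, Gamma_T)], provided that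
[Gamma_T] is coercive with constant [c]. Since [h] is continuous only where
[Gamma] is invertible, convergence in distribution is proved with the test
function [chi * (f o h) + (1 - chi) * M], where [M] bounds [|f|] and [chi] is a
continuous cutoff of the least eigenvalue of [Gamma] at level [c]; [c] is sent to
0 last. [P] has no meaning on non-measurable sets, so every event involved,
including the one on the supremum of the remainder, is shown measurable. *)

Set Implicit Arguments.
Unset Strict Implicit.
Unset Printing Implicit Defensive.

(** * Measurability through countable dense families *)

Section Measurability.
Context {R : realType} {d : measure_display} {Omega : measurableType d}.

(** A real power of the nonnegative function [f ^+ 2] is measurable, and the extra factor [f]
    restores the sign and the convention [0^-1 = 0]. *)
Lemma measurable_invr (f : Omega -> R) :
  measurable_fun setT f -> measurable_fun setT (fun w => (f w)^-1).
Proof.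
move=> mf.
have -> : (fun w => (f w)^-1) = (fun w => f w * (f w ^+ 2) `^ (-1)).
  apply/funext => w; rewrite powR_inv1 ?sqr_ge0//.
  have [->|f0] := eqVneq (f w) 0; first by rewrite invr0 mul0r.
  by rewrite expr2 invfM mulrA divff// mul1r.
apply: measurable_funM => //.
apply: (measurableT_comp (@measurable_powR R (-1))).
exact: measurable_funX.
Qed.

Lemma measurable_set_lt (f g : Omega -> R) : measurable_fun setT f ->
  measurable_fun setT g -> measurable [set w | f w < g w].
Proof.
move=> mf mg.
rewrite (_ : [set _ | _] = setT `&` (fun w => f w < g w) @^-1` [set true]);
  last by rewrite setTI.
by apply: (measurable_fun_ltr mf mg).
Qed.

Section Separable.
Context {V : pseudoMetricType R} {I : countType} (s : I -> V).
Hypothesis s_dense : forall (v : V) (e : R), 0 < e -> exists i, ball v e (s i).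

Lemma inv_nat_small (e : R) : 0 < e -> exists k : nat, k.+1%:R^-1 < e.
Proof.
move=> e0; exists (Num.truncn e^-1).
rewrite -[ltRHS]invrK ltf_pV2 ?posrE ?invr_gt0//.
by rewrite truncnS_gt.
Qed.

(** An open set is the union of those balls inside it that have their centre in the dense family and
    a radius [k.+1%:R^-1], and there are only countably many of these. The other balls enter the
    union as empty sets. *)
Lemma measurable_preimage_open (Z : Omega -> V) :
  (forall v e, measurable [set w | ball v e (Z w)]) ->
  forall U : set V, open U -> measurable (Z @^-1` U).
Proof.
move=> mZ U oU.
pose F (p : I * nat) : set Omega :=
  [set w | ball (s p.1) p.2.+1%:R^-1 (Z w) /\ ball (s p.1) p.2.+1%:R^-1 `<=` U].
have -> : Z @^-1` U = \bigcup_p F p.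
  apply/seteqP; split=> [w Uw|w [p _ [bp sU]]]; last exact: sU.
  have := oU; rewrite openE => /(_ _ Uw) /nbhs_ballP[e /= e0 eU].
  have [k ke] := inv_nat_small (divr_gt0 e0 (@ltr0n R 2)).
  have k0 : 0 < k.+1%:R^-1 :> R by rewrite invr_gt0.
  have [i bi] := s_dense (Z w) k0.
  exists (i, k) => //; split=> /=; first exact: ball_sym.
  move=> v bv; apply: eU; have := ball_triangle bi bv.
  by apply: le_ball; rewrite (splitr e) lerD// ltW.
apply: countable_bigcupT_measurable => // p.
have [sU|nsU] := pselect (ball (s p.1) p.2.+1%:R^-1 `<=` U).
  rewrite (_ : F p = [set w | ball (s p.1) p.2.+1%:R^-1 (Z w)])//.
  by apply/seteqP; split=> [w []|w bw].
by rewrite (_ : F p = set0)//; apply/seteqP; split=> // w [].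
Qed.

Lemma measurable_comp_continuous (Z : Omega -> V) (g : V -> R) :
  (forall v e, measurable [set w | ball v e (Z w)]) ->
  continuous g -> measurable_fun setT (fun w => g (Z w)).
Proof.
move=> mZ cg; apply: (measurability _ (RGenOpens.measurableE R)).
move=> _ [_ [a [b ->] <-]]; rewrite setTI.
apply: (@measurable_preimage_open Z mZ (g @^-1` `]a, b[%classic)).
by apply: open_comp => [x _|]; [exact: cg|exact: interval_open].
Qed.

(* A countable subset of [S], dense in [S], is enough to witness the supremum. *)
Lemma measurable_exists_gt (S : set V) (g : Omega -> V -> R) (e : R) :
  (forall u, S u -> measurable_fun setT (g ^~ u)) ->
  (forall w u, S u -> e < g w u ->
     exists2 dl, 0 < dl & forall u', S u' -> ball u dl u' -> e < g w u') ->
  measurable [set w | exists u, S u /\ e < g w u].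
Proof.
move=> mg cg.
have [[u0 _]|S0] := pselect (exists u, S u); last first.
  rewrite (_ : [set _ | _] = set0)//; apply/seteqP; split=> // w [u [Su _]].
  by apply: S0; exists u.
(* [S] may contain no point of the dense family, so every ball that meets [S] supplies a chosen
   point of [S]; the default [u0] stands in for the other balls. *)
pose pt (p : I * nat) := xget u0 (S `&` ball (s p.1) p.2.+1%:R^-1).
pose F (p : I * nat) : set Omega := [set w | S (pt p) /\ e < g w (pt p)].
have -> : [set w | exists u, S u /\ e < g w u] = \bigcup_p F p.
  apply/seteqP; split=> [w [u [Su egu]]|w [p _ Fp]]; last by exists (pt p).
  have [dl dl0 hdl] := cg _ _ Su egu.
  have [k ke] := inv_nat_small (divr_gt0 dl0 (@ltr0n R 2)).
  have k0 : 0 < k.+1%:R^-1 :> R by rewrite invr_gt0.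
  have [i bi] := s_dense u k0.
  have [Sp bp] : (S `&` ball (s i) k.+1%:R^-1) (pt (i, k)).
    by apply: (@xgetPex _ u0); exists u; split => //; exact: ball_sym.
  exists (i, k) => //; split => //; apply: hdl => //.
  have := ball_triangle bi bp.
  by apply: le_ball; rewrite (splitr dl) lerD// ltW.
apply: countable_bigcupT_measurable => // p.
have [Sp|nSp] := pselect (S (pt p)); last first.
  by rewrite (_ : F p = set0)//; apply/seteqP; split=> // w [].
rewrite (_ : F p = [set w | e < g w (pt p)]).
  by apply: measurable_set_lt => //; exact: mg.
by apply/seteqP; split=> [w []|w].
Qed.

End Separable.

Lemma ratr_mx_dense m n (A : 'M[R]_(m, n)) (e : R) : 0 < e ->
  exists Q : 'M[rat]_(m, n), ball A e (map_mx ratr Q).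
Proof.
move=> e0.
have h i j : exists q : rat, `|A i j - ratr q| < e.
  have [|q] := @rat_in_itvoo R (A i j - e) (A i j + e).
    by rewrite ltrBlDr -addrA ltrDl addr_gt0.
  by rewrite in_itv/= -ltr_distlC => qe; exists q.
exists (\matrix_(i, j) sval (cid (h i j))).
split=> // i j; rewrite !mxE; exact: (svalP (cid (h i j))).
Qed.

Lemma measurable_mx_ball m n (X : Omega -> 'M[R]_(m, n)) A e :
  (forall i j, measurable_fun setT (fun w => X w i j)) ->
  measurable [set w | ball A e (X w)].
Proof.
move=> mX; have [e0|e0] := ltP 0 e; last first.
  rewrite (_ : [set _ | _] = set0)//; apply/seteqP; split=> // w [/=].
  by rewrite ltNge e0.
rewrite (_ : [set _ | _] =
    \bigcap_(p in [set: 'I_m * 'I_n]) [set w | `|A p.1 p.2 - X w p.1 p.2| < e]).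
  apply: fin_bigcap_measurable => // p _; apply: measurable_set_lt => //.
  by apply: measurableT_comp => //; apply: measurable_funB.
apply/seteqP; split=> [w [_ b] p _|w b]; first exact: b.
by split => // i j; exact: (b (i, j)).
Qed.

Lemma measurable_continuous_mx m n (X : Omega -> 'M[R]_(m, n)) (g : 'M[R]_(m, n) -> R) :
  (forall i j, measurable_fun setT (fun w => X w i j)) -> continuous g ->
  measurable_fun setT (fun w => g (X w)).
Proof.
move=> mX; apply: (@measurable_comp_continuous _ _ (@map_mx _ R ratr m n)).
  exact: ratr_mx_dense.
by move=> A e; exact: measurable_mx_ball.
Qed.

Lemma measurable_continuous_mx2 m n m' n' (X : Omega -> 'M[R]_(m, n))
    (Y : Omega -> 'M[R]_(m', n')) (g : 'M[R]_(m, n) * 'M[R]_(m', n') -> R) :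
  (forall i j, measurable_fun setT (fun w => X w i j)) ->
  (forall i j, measurable_fun setT (fun w => Y w i j)) -> continuous g ->
  measurable_fun setT (fun w => g (X w, Y w)).
Proof.
move=> mX mY.
apply: (@measurable_comp_continuous ('M[R]_(m, n) * 'M[R]_(m', n'))%type _ (fun Q :
  'M[rat]_(m, n) * 'M[rat]_(m', n') => (map_mx ratr Q.1, map_mx ratr Q.2))).
  move=> [A B] e e0.
  have [P AP] := ratr_mx_dense A e0; have [Q BQ] := ratr_mx_dense B e0.
  by exists (P, Q).
move=> [A B] e.
rewrite (_ : [set _ | _] = [set w | ball A e (X w)] `&` [set w | ball B e (Y w)])//.
by apply: measurableI; exact: measurable_mx_ball.
Qed.

End Measurability.

(** * Determinants and adjugates over an algebra of functions *)

Section FunctionAlgebra.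
Context {R : realType} {X : Type} (C : (X -> R) -> Prop).
Hypothesis C_cst : forall k, C (fun=> k).
Hypothesis C_add : forall f g, C f -> C g -> C (fun x => f x + g x).
Hypothesis C_mul : forall f g, C f -> C g -> C (fun x => f x * g x).

Lemma falg_sum (I : Type) (s : seq I) (Q : pred I) (f : I -> X -> R) :
  (forall i, C (f i)) -> C (fun x => \sum_(i <- s | Q i) f i x).
Proof.
move=> hf; elim: s => [|i s IH].
  by rewrite (_ : (fun _ => _) = (fun=> 0))//; apply/funext => x; rewrite big_nil.
case: (boolP (Q i)) => Qi; last first.
  rewrite (_ : (fun _ => _) = (fun x => \sum_(i <- s | Q i) f i x))//.
  by apply/funext => x; rewrite big_cons (negbTE Qi).
rewrite (_ : (fun _ => _) = (fun x => f i x + \sum_(i <- s | Q i) f i x)).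
  exact: C_add.
by apply/funext => x; rewrite big_cons Qi.
Qed.

Lemma falg_prod (I : Type) (s : seq I) (f : I -> X -> R) :
  (forall i, C (f i)) -> C (fun x => \prod_(i <- s) f i x).
Proof.
move=> hf; elim: s => [|i s IH].
  by rewrite (_ : (fun _ => _) = (fun=> 1))//; apply/funext => x; rewrite big_nil.
rewrite (_ : (fun _ => _) = (fun x => f i x * \prod_(i <- s) f i x)).
  exact: C_mul.
by apply/funext => x; rewrite big_cons.
Qed.

(** By the Leibniz formula the determinant is a polynomial in the entries. [C] is later both
    continuity at a point and measurability, which share this argument. *)
Lemma falg_det n (A : X -> 'M[R]_n) :
  (forall i j, C (fun x => A x i j)) -> C (fun x => \det (A x)).
Proof.
move=> hA; apply: falg_sum => s; apply: C_mul; first exact: C_cst.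
by apply: falg_prod => i; exact: hA.
Qed.

Lemma falg_adj n (A : X -> 'M[R]_n) :
  (forall i j, C (fun x => A x i j)) -> forall i j, C (fun x => (\adj (A x)) i j).
Proof.
move=> hA i j.
rewrite (_ : (fun _ => _) =
    (fun x => (-1) ^+ (j + i) * \det (row' j (col' i (A x))))); last first.
  by apply/funext => x; rewrite mxE.
apply: C_mul; first exact: C_cst.
apply: falg_det => k l.
by rewrite (_ : (fun _ => _) = (fun x => A x (lift j k) (lift i l)))//;
  apply/funext => x; rewrite !mxE.
Qed.

End FunctionAlgebra.

(** * Selection of coordinates by a 0-1 matrix *)

Section Selection.
Context {R : realType} {n : nat} (J : {set 'I_n}).

(** Right multiplication by the transpose restricts a row to [J], and right multiplication by
    [selmx] extends it by zero. Restricted quadratic forms then become products of matrices. *)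
Definition selmx : 'M[R]_(#|J|, n) := \matrix_(i, j) (j == enum_val i)%:R.

Lemma selmx_mulr m (A : 'M[R]_(m, n)) i j : (A *m selmx^T) i j = A i (enum_val j).
Proof.
rewrite mxE (bigD1 (enum_val j))//= big1 ?addr0; last first.
  by move=> k kj; rewrite !mxE (negbTE kj) mulr0.
by rewrite !mxE eqxx mulr1.
Qed.

Lemma subrowJE (u : 'rV[R]_n) : subrowJ J u = u *m selmx^T.
Proof. by apply/rowP => i; rewrite selmx_mulr mxE. Qed.

Lemma prinsubmxE (A : 'M[R]_n) : prinsubmx J A = selmx *m A *m selmx^T.
Proof.
apply/matrixP => i j; rewrite selmx_mulr mxE mxE (bigD1 (enum_val i))//= big1.
  by rewrite !mxE eqxx mul1r addr0.
by move=> k ki; rewrite !mxE (negbTE ki) mul0r.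
Qed.

Lemma selmxK : selmx *m selmx^T = 1%:M.
Proof.
apply/matrixP => i j; rewrite selmx_mulr !mxE.
by rewrite (inj_eq enum_val_inj) eq_sym.
Qed.

Lemma selmx_in (h : 'rV[R]_#|J|) i : (h *m selmx) 0 (enum_val i) = h 0 i.
Proof. by rewrite -(selmx_mulr (h *m selmx)) -mulmxA selmxK mulmx1. Qed.

Lemma selmx_out (h : 'rV[R]_#|J|) j : j \notin J -> (h *m selmx) 0 j = 0.
Proof.
move=> jJ; rewrite mxE big1// => i _; rewrite mxE.
case: eqP => [ji|_]; last by rewrite mulr0.
by rewrite ji enum_valP in jJ.
Qed.

Lemma selmx_proj (u : 'rV[R]_n) j :
  (u *m selmx^T *m selmx) 0 j = if j \in J then u 0 j else 0.
Proof.
case: ifPn => [jJ|]; last exact: selmx_out.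
by rewrite -(enum_rankK_in jJ jJ) selmx_in selmx_mulr.
Qed.

End Selection.
Arguments selmx {R n} J.

(** * Continuity at a point *)

(* Eta-expanded forms of [continuousD], [continuousM], etc, which unify up to
   syntax and so spare the unfolding of the matrix topology. *)
Section ContinuousAt.
Context {R : realType} {V : topologicalType} (x : V).
Implicit Types f g : V -> R.

Lemma continuous_at_cst (k : R) : {for x, continuous (fun _ : V => k)}.
Proof. exact: cvg_cst. Qed.

Lemma continuous_atD f g : {for x, continuous f} -> {for x, continuous g} ->
  {for x, continuous (fun v => f v + g v)}.
Proof. by move=> cf cg; exact: cvgD. Qed.

Lemma continuous_atB f g : {for x, continuous f} -> {for x, continuous g} ->
  {for x, continuous (fun v => f v - g v)}.
Proof. by move=> cf cg; exact: cvgB. Qed.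

Lemma continuous_atM f g : {for x, continuous f} -> {for x, continuous g} ->
  {for x, continuous (fun v => f v * g v)}.
Proof. by move=> cf cg; exact: cvgM. Qed.

Lemma continuous_at_norm f : {for x, continuous f} ->
  {for x, continuous (fun v => `|f v|)}.
Proof. by move=> cf; exact: cvg_norm. Qed.

Lemma continuous_at_sum (I : Type) (s : seq I) (Q : pred I) (f : I -> V -> R) :
  (forall i, {for x, continuous (f i)}) ->
  {for x, continuous (fun v => \sum_(i <- s | Q i) f i v)}.
Proof.
apply: (@falg_sum R V (fun f => {for x, continuous f})).
  exact: continuous_at_cst.
exact: continuous_atD.
Qed.

Lemma continuous_at_entry m n (A : V -> 'M[R]_(m, n)) i j :
  {for x, continuous A} -> {for x, continuous (fun v => A v i j)}.
Proof.
move=> cA; apply: (@continuous_comp _ _ _ A (fun M => M i j)) => //.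
exact: coord_continuous.
Qed.

End ContinuousAt.

(** * Coercivity constants of quadratic forms *)

Section Coercivity.
Context {R : realType}.

Definition qform n (A : 'M[R]_n) (u : 'rV[R]_n) : R := (u *m A *m u^T) 0 0.
Definition coercive n (A : 'M[R]_n) (c : R) : Prop :=
  forall u : 'rV[R]_n, c * \sum_j u 0 j ^+ 2 <= qform A u.
Definition entry_dist n (A B : 'M[R]_n) : R := \sum_i \sum_j `|A i j - B i j|.
(* The smallest eigenvalue of the symmetric part of [A], capped at 1. *)
Definition coerc n (A : 'M[R]_n) : R := sup [set c | c <= 1 /\ coercive A c].

Lemma qformE n (A : 'M[R]_n) u : qform A u = \sum_i \sum_j A i j * (u 0 i * u 0 j).
Proof.
rewrite /qform mxE exchange_big/=; apply: eq_bigr => j _.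
rewrite !mxE mulr_suml; apply: eq_bigr => i _.
by ring.
Qed.

Lemma mul_le_sumsq n (u : 'rV[R]_n) i j : `|u 0 i * u 0 j| <= \sum_k u 0 k ^+ 2.
Proof.
have le k : u 0 k ^+ 2 <= \sum_k u 0 k ^+ 2.
  by rewrite (bigD1 k)//= lerDl sumr_ge0// => l _; exact: sqr_ge0.
have := le i; have := le j; rewrite -(real_normK (num_real (u 0 i))).
rewrite -(real_normK (num_real (u 0 j))) normrM.
by set s := \sum_k _; nra.
Qed.

(** Each product [u 0 i * u 0 j] is at most the squared norm of [u], so replacing [A] by [B] changes
    the form by at most [entry_dist A B] times that squared norm. *)
Lemma coercive_dist n (A B : 'M[R]_n) c :
  coercive A c -> coercive B (c - entry_dist A B).
Proof.
move=> hA u; rewrite mulrBl; apply: (le_trans (lerB (hA u) (lexx _))).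
rewrite lerBlDr addrC -lerBlDr !qformE -sumrB mulr_suml; apply: ler_sum => i _.
rewrite -sumrB mulr_suml; apply: ler_sum => j _.
rewrite -mulrBl; apply: (le_trans (ler_norm _)); rewrite normrM.
by apply: ler_wpM2l => //; exact: mul_le_sumsq.
Qed.

Lemma coercive_le n (A : 'M[R]_n) c c' : c' <= c -> coercive A c -> coercive A c'.
Proof.
move=> cc hA u; apply: le_trans (hA u); apply: ler_wpM2r => //.
by apply: sumr_ge0 => j _; exact: sqr_ge0.
Qed.

(** The zero matrix is coercive with constant 0, and perturbing it into [A] gives a member of the
    set. The cap at 1 bounds the set even for [n = 0], where every constant is coercive. *)
Lemma coerc_has_sup n (A : 'M[R]_n) : has_sup [set c | c <= 1 /\ coercive A c].
Proof.
split; last by exists 1 => c [].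
exists (0 - entry_dist 0 A); split.
  rewrite sub0r lerNl (le_trans _ (_ : 0 <= _))//.
  by apply: sumr_ge0 => i _; apply: sumr_ge0.
apply: coercive_dist => u; rewrite mul0r qformE; apply: sumr_ge0 => i _.
by apply: sumr_ge0 => j _; rewrite mxE mul0r.
Qed.

Lemma coerc_ge n (A : 'M[R]_n) c : c <= 1 -> coercive A c -> c <= coerc A.
Proof.
by move=> c1 hA; apply: ub_le_sup; [exact: (coerc_has_sup A).2|split].
Qed.

Lemma coerc_coercive n (A : 'M[R]_n) c : c < coerc A -> coercive A c.
Proof.
move=> cA; have e0 : 0 < coerc A - c by rewrite subr_gt0.
have [c' [_ hc']] := sup_adherent e0 (coerc_has_sup A).
by rewrite subKr => /ltW; move/coercive_le; apply.
Qed.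

(** This is a Lipschitz bound for [coerc]; it yields continuity without any eigenvalue theory. *)
Lemma coerc_dist n (A B : 'M[R]_n) : coerc A - entry_dist A B <= coerc B.
Proof.
rewrite lerBlDr; apply: ge_sup; first exact: (coerc_has_sup A).1.
move=> c [c1 hA]; rewrite -lerBlDr; apply: coerc_ge; last exact: coercive_dist.
rewrite lerBlDr (le_trans c1)// lerDl.
by apply: sumr_ge0 => i _; apply: sumr_ge0.
Qed.

Lemma entry_distC n (A B : 'M[R]_n) : entry_dist A B = entry_dist B A.
Proof. by apply: eq_bigr => i _; apply: eq_bigr => j _; rewrite distrC. Qed.

Lemma coerc_continuous n : continuous (@coerc n).
Proof.
move=> A; apply/(@cvgrPdist_lt _ _ _ (nbhs A)) => e e0.
have dA : {for A, continuous (fun B : 'M[R]_n => \sum_i \sum_j `|A i j - B i j|)}.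
  apply: continuous_at_sum => i; apply: continuous_at_sum => j.
  apply: continuous_at_norm; apply: continuous_atB; first exact: continuous_at_cst.
  exact: coord_continuous.
have dAA : entry_dist A A = 0.
  by apply: big1 => i _; apply: big1 => j _; rewrite subrr normr0.
have /(@cvgrPdist_lt _ _ _ (nbhs A))/(_ _ e0) := dA.
apply: filterS => B; rewrite -/(entry_dist A A) -/(entry_dist A B) dAA sub0r normrN.
move=> /(le_lt_trans (ler_norm _)) dB.
rewrite ltr_norml; have := coerc_dist A B; have := coerc_dist B A.
by rewrite (entry_distC B); move: dB; lra.
Qed.

Lemma box_compact n (K : R) : compact [set v : 'rV[R]_n | forall i, `|v 0 i| <= K].
Proof.
rewrite (_ : [set v | _] = [set v : 'rV[R]_n | forall i, `[(- K), K]%classic (v 0 i)]).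
  apply: (@rV_compact R n (fun=> `[(- K), K]%classic)) => i.
  exact: segment_compact.
by apply/seteqP; split=> v hv i; have := hv i; rewrite /= in_itv/= ler_norml.
Qed.

Lemma qform_continuous n (A : 'M[R]_n) : continuous (qform A).
Proof.
move=> u; rewrite (_ : qform A = fun u => \sum_i \sum_j A i j * (u 0 i * u 0 j)).
  apply: continuous_at_sum => i; apply: continuous_at_sum => j.
  apply: continuous_atM; first exact: continuous_at_cst.
  by apply: continuous_atM; exact: coord_continuous.
by apply/funext => v; exact: qformE.
Qed.

Lemma sumsq_eq0 n (u : 'rV[R]_n) : \sum_j u 0 j ^+ 2 = 0 -> u = 0.
Proof.
move=> /eqP; rewrite psumr_eq0; last by move=> i _; exact: sqr_ge0.
move=> /allP h; apply/rowP => i; rewrite mxE.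
by apply/eqP; rewrite -sqrf_eq0; apply: h; rewrite mem_index_enum.
Qed.

(** The form attains a positive minimum on the compact unit sphere [S], and homogeneity carries this
    minimum over to all vectors. *)
Lemma posdef_coerc_gt0 n (A : 'M[R]_n) : posdef A -> 0 < coerc A.
Proof.
move=> [_ pA].
pose S := [set u : 'rV[R]_n | \sum_j u 0 j ^+ 2 = 1].
have scale (u : 'rV[R]_n) : u != 0 -> exists2 t, 0 < t &
    S (t *: u) /\ qform A (t *: u) * \sum_j u 0 j ^+ 2 = qform A u.
  move=> u0; set s := \sum_j _.
  have s0 : 0 < s.
    rewrite lt_neqAle sumr_ge0 ?andbT; last by move=> j _; exact: sqr_ge0.
    by rewrite eq_sym; apply: contra u0 => /eqP/sumsq_eq0/eqP.
  have ss : (Num.sqrt s)^-1 ^+ 2 * s = 1.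
    by rewrite exprVn sqr_sqrtr ?ltW// mulVf ?gt_eqF.
  exists (Num.sqrt s)^-1; first by rewrite invr_gt0 sqrtr_gt0.
  split.
    rewrite /S/= -ss mulr_sumr; apply: eq_bigr => j _.
    by rewrite mxE exprMn.
  rewrite -[RHS]mul1r -ss; rewrite [in RHS]mulrAC; congr (_ * _).
  rewrite !qformE mulr_sumr; apply: eq_bigr => i _.
  rewrite mulr_sumr; apply: eq_bigr => j _; rewrite !mxE.
  by rewrite expr2; ring.
have coer c : c <= 1 -> (forall u, S u -> c <= qform A u) -> c <= coerc A.
  move=> c1 hc; apply: coerc_ge => // u.
  have [->|u0] := eqVneq u 0.
    rewrite /qform !mul0mx mxE big1 ?mulr0// => j _.
    by rewrite mxE expr0n.
  have [t t0 [St <-]] := scale u u0.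
  apply: ler_wpM2r; last exact: hc.
  by apply: sumr_ge0 => j _; exact: sqr_ge0.
(* The sphere is empty when [n = 0]; the constant 1 then works vacuously. *)
have [S0|S0] := pselect (S !=set0); last first.
  apply: (lt_le_trans ltr01); apply: coer => // u Su.
  by case: S0; exists u.
have cS : compact S.
  apply: (subclosed_compact _ (@box_compact n 1)).
    have sc : continuous (fun u : 'rV[R]_n => \sum_j u 0 j ^+ 2).
      move=> u; apply: continuous_at_sum => j.
      by apply: continuous_atM; exact: coord_continuous.
    rewrite (_ : S = (fun u : 'rV[R]_n => \sum_j u 0 j ^+ 2) @^-1` [set 1])//.
    by apply: closed_comp; [move=> u _; exact: sc|exact: closed_eq].
  move=> u; rewrite /S/= => Su i.
  have := mul_le_sumsq u i i; rewrite Su normrM.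
  by rewrite -expr2 expr_le1.
have [|u /set_mem Su hu] := compact_EVT_min S0 cS (f := qform A).
  by apply: continuous_subspaceT; exact: qform_continuous.
have q0 : 0 < qform A u.
  apply: pA; apply/eqP => u0; move: Su; rewrite u0 /S/= big1.
    by move/esym/eqP; rewrite oner_eq0.
  by move=> j _; rewrite mxE expr0n.
apply: (@lt_le_trans _ _ (Num.min 1 (qform A u))); first by rewrite lt_min ltr01.
apply: coer; first by rewrite ge_min lexx.
by move=> v Sv; rewrite ge_min (hu v) ?orbT//; exact/mem_set.
Qed.

End Coercivity.

(** * The maximizer of the limiting quadratic criterion *)

Section QuadraticMaximizer.
Context {R : realType} {n : nat} (J : {set 'I_n}).
Implicit Types (A : 'M[R]_n) (z : 'rV[R]_n * 'M[R]_n).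

(** [GammaT] is not assumed symmetric, whereas the criterion depends only on the symmetric part; the
    stationarity equation must therefore be written with that part. *)
Definition symmx A : 'M[R]_n := 2^-1 *: (A + A^T).

(* The maximizer over [x] of [(D - psi) u^T - u A u^T / 2], [u = x *m selmx J];
   it agrees with the [invmx] formula when [A] is symmetric positive definite. *)
Definition laq_sol (psi : 'rV[R]_n) z : 'rV[R]_#|J| :=
  ((\det (prinsubmx J (symmx z.2)))^-1 *: \adj (prinsubmx J (symmx z.2))
    *m (subrowJ J z.1 - subrowJ J psi)^T)^T.

Definition laq (D : 'rV[R]_n) A (u : 'rV[R]_n) : R :=
  (D *m u^T) 0 0 - 2^-1 * qform A u.

Lemma symmx_id A : A^T = A -> symmx A = A.
Proof.
by move=> sA; rewrite /symmx sA; apply/matrixP => i j; rewrite !mxE; lra.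
Qed.

Lemma trmx_symmx A : (symmx A)^T = symmx A.
Proof. by rewrite /symmx linearZ/= linearD/= trmxK addrC. Qed.

Lemma qform_symmx A u : qform (symmx A) u = qform A u.
Proof.
rewrite /qform /symmx -scalemxAr -scalemxAl mulmxDr mulmxDl mxE [X in _ * X]mxE.
have -> : (u *m A^T *m u^T) 0 0 = (u *m A *m u^T) 0 0.
  rewrite -[u *m A^T *m u^T]trmxK [in LHS]mxE; congr (_ _ _).
  by rewrite !trmx_mul !trmxK mulmxA.
by lra.
Qed.

Lemma trmx_prinsubmx A : A^T = A -> (prinsubmx J A)^T = prinsubmx J A.
Proof. by move=> sA; rewrite prinsubmxE !trmx_mul trmxK sA mulmxA. Qed.

Lemma qform_prinsubmx A (x : 'rV[R]_#|J|) :
  qform (prinsubmx J (symmx A)) x = qform A (x *m selmx J).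
Proof.
rewrite -(qform_symmx A) /qform prinsubmxE.
by rewrite trmx_mul !mulmxA.
Qed.

Lemma sumsq_selmx (x : 'rV[R]_#|J|) :
  \sum_j (x *m selmx J) 0 j ^+ 2 = \sum_i x 0 i ^+ 2.
Proof.
have E m (u : 'rV[R]_m) : \sum_j u 0 j ^+ 2 = (u *m u^T) 0 0.
  by rewrite mxE; apply: eq_bigr => j _; rewrite mxE.
by rewrite !E trmx_mul -mulmxA [selmx J *m _]mulmxA selmxK mul1mx.
Qed.

(** A kernel vector of the submatrix, extended by zero, would annihilate the form of [A], against
    coercivity. *)
Lemma coercive_det A c : 0 < c -> coercive A c ->
  \det (prinsubmx J (symmx A)) != 0.
Proof.
move=> c0 hA; apply/det0P => -[x x0 xS].
have := hA (x *m selmx J); rewrite -qform_prinsubmx sumsq_selmx /qform xS mul0mx.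
rewrite mxE pmulr_rle0// => sx.
move/eqP: x0; apply; apply: sumsq_eq0; apply: le_anti; rewrite sx/=.
by apply: sumr_ge0 => j _; exact: sqr_ge0.
Qed.

Lemma laq_sol_eq psi z : \det (prinsubmx J (symmx z.2)) != 0 ->
  laq_sol psi z *m prinsubmx J (symmx z.2) = subrowJ J z.1 - subrowJ J psi.
Proof.
move=> d0; apply: trmx_inj; rewrite trmx_mul trmxK trmx_prinsubmx ?trmx_symmx//.
rewrite mulmxA -scalemxAr mul_mx_adj scale_scalar_mx mulVf//.
by rewrite mul1mx.
Qed.

Lemma laq_sol_invmx psi z : posdef z.2 -> laq_sol psi z =
  (invmx (prinsubmx J z.2) *m (subrowJ J z.1 - subrowJ J psi)^T)^T.
Proof.
move=> pz; have [c0 cz] : 0 < coerc z.2 / 2 /\ coerc z.2 / 2 < coerc z.2.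
  by have := posdef_coerc_gt0 pz; lra.
have := coercive_det c0 (coerc_coercive cz).
by rewrite /laq_sol /invmx symmx_id ?pz.1// unitmxE unitfE => ->.
Qed.

(** Completing the square: [laq_sol_eq] expresses the linear term through the maximizer, and the
    symmetry of the submatrix merges the two cross terms. *)
Lemma laq_gap psi z (x : 'rV[R]_#|J|) : \det (prinsubmx J (symmx z.2)) != 0 ->
  laq (z.1 - psi) z.2 (laq_sol psi z *m selmx J) - laq (z.1 - psi) z.2 (x *m selmx J)
  = 2^-1 * qform z.2 ((x - laq_sol psi z) *m selmx J).
Proof.
move=> /(laq_sol_eq psi); set h := laq_sol psi z => hE.
rewrite /laq -!qform_prinsubmx.
have dotE y : ((z.1 - psi) *m (y *m selmx J)^T) 0 0
    = (h *m prinsubmx J (symmx z.2) *m y^T) 0 0.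
  by rewrite hE !subrowJE trmx_mul mulmxA mulmxBl.
rewrite !dotE; move: (prinsubmx J (symmx z.2)) (trmx_prinsubmx (trmx_symmx z.2)).
move=> S sS; rewrite /qform.
have xh : (x *m S *m h^T) 0 0 = (h *m S *m x^T) 0 0.
  rewrite -[x *m S *m h^T]trmxK [in LHS]mxE.
  by rewrite !trmx_mul !trmxK mulmxA sS.
have -> : (x - h) *m S *m (x - h)^T =
    x *m S *m x^T - x *m S *m h^T - (h *m S *m x^T - h *m S *m h^T).
  by rewrite linearB/= mulmxBl mulmxBl !mulmxBr.
have mxB (M N : 'M[R]_1) : (M - N) 0 0 = M 0 0 - N 0 0 by rewrite !mxE.
by rewrite !mxB xh; lra.
Qed.

(** Testing the stationarity equation against the solution bounds [c] times its squared norm by a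
    linear term, half of which Young's inequality absorbs. The bound depends only on [n], [K] and
    [c], hence is uniform over a good event. *)
Lemma laq_sol_bound (psi : 'rV[R]_n) z (c K : R) : 0 < c -> coercive z.2 c ->
  (forall j, `|z.1 0 j - psi 0 j| <= K) ->
  forall i, `|laq_sol psi z 0 i| <= n%:R * (K / c) ^+ 2 + 1.
Proof.
move=> c0 hc hK.
move: (laq_sol psi z) (laq_sol_eq psi (coercive_det c0 hc)) => h hE i.
have hh := hc (h *m selmx J).
rewrite sumsq_selmx -qform_prinsubmx /qform hE mxE in hh.
have young l : (subrowJ J z.1 - subrowJ J psi) 0 l * h^T l 0
    <= 2^-1 * (c * (K / c) ^+ 2) + 2^-1 * (c * h 0 l ^+ 2).
  have := hK (enum_val l); rewrite !mxE; move: (z.1 0 _ - _) (h 0 l) => b t bK.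
  have : b * t <= c * (K / c) * `|t|.
    apply: (le_trans (ler_norm _)); rewrite normrM; apply: ler_wpM2r => //.
    by rewrite mulrCA divff ?mulr1// gt_eqF.
  rewrite -(real_normK (num_real t)); move: (K / c) `|t| => k s bt.
  have : 0 <= c * (k - s) ^+ 2 by rewrite mulr_ge0 ?sqr_ge0 ?ltW.
  by nra.
have sumh : \sum_l h 0 l ^+ 2 <= n%:R * (K / c) ^+ 2.
  have le1 := le_trans hh (ler_sum _ (fun l _ => young l)).
  rewrite big_split/= sumr_const -!mulr_sumr card_ord in le1.
  have le2 : c * \sum_l h 0 l ^+ 2 <= c * (#|J|%:R * (K / c) ^+ 2).
    by move: le1; rewrite -mulr_natl; lra.
  move: le2; rewrite ler_pM2l// => /le_trans; apply.
  apply: ler_wpM2r; first exact: sqr_ge0.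
  by rewrite ler_nat -[leqRHS]card_ord; exact: max_card.
have : `|h 0 i| ^+ 2 <= n%:R * (K / c) ^+ 2.
  apply: le_trans sumh; rewrite real_normK ?num_real// (bigD1 i)//= lerDl.
  by apply: sumr_ge0 => j _; exact: sqr_ge0.
(* A number whose square is at most [B] is at most [B + 1], which avoids a square root in the
   bound. *)
by move: (n%:R * _) `|h 0 i| => B t; nra.
Qed.

Lemma continuous_at_mx (V : topologicalType) (v : V) m k (A : V -> 'M[R]_(m, k)) :
  (forall i j, {for v, continuous (fun w => A w i j)}) -> {for v, continuous A}.
Proof.
move=> cA; apply/cvg_ballP => e e0.
have : \forall w \near v, forall i j, ball (A v i j) e (A w i j).
  apply: filter_forall => i; apply: filter_forall => j.
  by have /cvg_ballP/(_ _ e0) := cA i j.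
by apply: filterS.
Qed.

(** The adjugate formula makes every coordinate a rational function of the entries of [z], with the
    determinant as its only denominator. *)
Lemma laq_sol_continuous psi z : \det (prinsubmx J (symmx z.2)) != 0 ->
  {for z, continuous (laq_sol psi)}.
Proof.
move=> d0; apply: continuous_at_mx => k i; rewrite (ord1 k).
have c1 j : {for z, continuous (fun z : 'rV[R]_n * 'M[R]_n => z.1 0 j)}.
  by apply: continuous_at_entry; exact: cvg_fst.
have c2 j l : {for z, continuous (fun z : 'rV[R]_n * 'M[R]_n => z.2 j l)}.
  by apply: continuous_at_entry; exact: cvg_snd.
have cS j l : {for z, continuous (fun z : 'rV[R]_n * 'M[R]_n =>
    prinsubmx J (symmx z.2) j l)}.
  rewrite (_ : (fun _ => _) = (fun z : 'rV[R]_n * 'M[R]_n =>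
    2^-1 * (z.2 (enum_val j) (enum_val l) + z.2 (enum_val l) (enum_val j)))).
    apply: continuous_atM; first exact: continuous_at_cst.
    exact: continuous_atD.
  by apply/funext => y; rewrite !mxE.
rewrite (_ : (fun _ => _) = (fun z : 'rV[R]_n * 'M[R]_n =>
  \sum_j ((\det (prinsubmx J (symmx z.2)))^-1 * \adj (prinsubmx J (symmx z.2)) i j)
    * (z.1 0 (enum_val j) - psi 0 (enum_val j)))); last first.
  apply/funext => y; rewrite mxE mxE; apply: eq_bigr => j _.
  by congr (_ * _); [rewrite mxE|rewrite !mxE].
apply: continuous_at_sum => j; apply: continuous_atM; last first.
  by apply: continuous_atB => //; exact: continuous_at_cst.
apply: continuous_atM.
  apply: continuousV => //.
  apply: (@falg_det R _ (fun f => {for z, continuous f})) => //.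
  - exact: continuous_at_cst.
  - exact: continuous_atD.
  - exact: continuous_atM.
apply: (@falg_adj R _ (fun f => {for z, continuous f})) => //.
- exact: continuous_at_cst.
- exact: continuous_atD.
- exact: continuous_atM.
Qed.

End QuadraticMaximizer.

(** * Norm comparisons and a Lipschitz bound for the quadratic criterion *)

Section Bounds.
Context {R : realType} {n : nat}.

Lemma enorm_on_le (J : {set 'I_n}) (u : 'rV[R]_n) (M : R) : 0 <= M ->
  (forall j, j \in J -> `|u 0 j| <= M) -> enorm_on J u <= n%:R * M.
Proof.
move=> M0 hu; rewrite /enorm_on.
have nM : 0 <= n%:R * M by rewrite mulr_ge0.
rewrite -(ger0_norm nM) -sqrtr_sqr ler_wsqrtr//.
apply: (@le_trans _ _ (\sum_(j in J) M ^+ 2)).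
  by apply: ler_sum => j /hu uM; rewrite -(real_normK (num_real (u 0 j))) lerXn2r// nnegrE.
(* The cardinality of [J] is bounded by [n], then crudely by [n ^ 2], so that the square root is
   exact. *)
rewrite sumr_const -[leLHS]mulr_natl exprMn; apply: ler_wpM2r; first exact: sqr_ge0.
rewrite -natrX ler_nat (@leq_trans n)//.
  by rewrite -[leqRHS]card_ord; exact: max_card.
by case: n => // k; rewrite -mulnn leq_pmulr.
Qed.

Lemma enormE (u : 'rV[R]_n) : enorm u = enorm_on [set: 'I_n]%SET u.
Proof. by rewrite /enorm /enorm_on; congr Num.sqrt; apply: eq_bigl => j; rewrite inE. Qed.

Lemma entry_le_enorm (u : 'rV[R]_n) j : `|u 0 j| <= enorm u.
Proof.
rewrite /enorm -sqrtr_sqr ler_wsqrtr// (bigD1 j)//= lerDl.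
by apply: sumr_ge0 => i _; exact: sqr_ge0.
Qed.

Lemma mul_trmxE (D u : 'rV[R]_n) : (D *m u^T) 0 0 = \sum_j D 0 j * u 0 j.
Proof. by rewrite mxE; apply: eq_bigr => j _; rewrite mxE. Qed.

(** A product [u 0 i * u 0 j] varies by at most [2 * K * dl]; the weight [K] of an entry of [G] and
    the factor one half of the criterion leave [K ^+ 2 * dl] for each of the [n * n] entries. *)
Lemma laq_lipschitz (D : 'rV[R]_n) (G : 'M[R]_n) (u v : 'rV[R]_n) (K dl : R) :
  (forall j, `|D 0 j| <= K) -> (forall i j, `|G i j| <= K) ->
  (forall j, `|u 0 j| <= K) -> (forall j, `|v 0 j| <= K) ->
  (forall j, `|u 0 j - v 0 j| <= dl) ->
  `|laq D G u - laq D G v| <= (n%:R * K + (n * n)%:R * K ^+ 2) * dl.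
Proof.
move=> hD hG hu hv huv; rewrite /laq !mul_trmxE !qformE.
have h1 : `|\sum_j D 0 j * u 0 j - \sum_j D 0 j * v 0 j| <= n%:R * K * dl.
  rewrite -sumrB; apply: (le_trans (ler_norm_sum _ _ _)).
  rewrite -mulrA -[n in n%:R]card_ord mulr_natl -sumr_const; apply: ler_sum => j _.
  by rewrite -mulrBr normrM; apply: ler_pM.
have h2 : `|\sum_i \sum_j G i j * (u 0 i * u 0 j) -
    \sum_i \sum_j G i j * (v 0 i * v 0 j)| <= (n * n)%:R * (2 * K ^+ 2 * dl).
  rewrite -sumrB; apply: (le_trans (ler_norm_sum _ _ _)).
  rewrite natrM -mulrA -[n in n%:R * (_ * _)]card_ord mulr_natl -sumr_const.
  apply: ler_sum => i _; rewrite -sumrB; apply: (le_trans (ler_norm_sum _ _ _)).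
  rewrite -[n in n%:R]card_ord mulr_natl -sumr_const; apply: ler_sum => j _.
  rewrite -mulrBr normrM.
  have K0 : 0 <= K by exact: le_trans (hu i).
  have dl0 : 0 <= dl by exact: le_trans (huv i).
  have -> : u 0 i * u 0 j - v 0 i * v 0 j =
    u 0 i * (u 0 j - v 0 j) + (u 0 i - v 0 i) * v 0 j by ring.
  have le2 : `|u 0 i * (u 0 j - v 0 j) + (u 0 i - v 0 i) * v 0 j| <= 2 * K * dl.
    apply: (le_trans (ler_normD _ _)); rewrite !normrM.
    have := ler_pM (normr_ge0 _) (normr_ge0 _) (hu i) (huv j).
    have := ler_pM (normr_ge0 _) (normr_ge0 _) (huv i) (hv j).
    by lra.
  have := ler_pM (normr_ge0 _) (normr_ge0 _) (hG i j) le2.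
  by move/le_trans; apply; rewrite expr2; lra.
move: h1 h2; rewrite !ler_norml => /andP[? ?] /andP[? ?].
by apply/andP; split; lra.
Qed.

End Bounds.

(** * Deterministic localization of the estimator *)

(* On the event where all random quantities are controlled by [K] and [e], the
   estimator is localized by comparing the penalized criterion at [th] with its
   value at two competitors: [th] with its null coordinates set to zero, and the
   maximizer of the limiting quadratic form. *)
Section Localization.
Context {R : realType} {n : nat} (Theta : set 'rV[R]_n) (thstar : 'rV[R]_n).
Context (rho : R) (pen : R -> R) (q K K2 Rad e : R) (x a : 'I_n -> R).
Context (th D : 'rV[R]_n) (G : 'M[R]_n) (rr Hf : 'rV[R]_n -> R).
Let J1 := [set j : 'I_n | thstar 0 j != 0]%SET.
Let adiag := diag_mx (\row_j a j).
Let ut j := (th 0 j - thstar 0 j) / (if thstar 0 j == 0 then x j `^ (- q^-1) else a j).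
(** The expansion [A10] concerns the scaling [v] by [a] in all coordinates, while tightness concerns
    [ut], scaled differently in the null ones. *)
Let v : 'rV[R]_n := \row_j ((th 0 j - thstar 0 j) / a j).

Hypothesis hball : forall t : 'rV[R]_n,
  (forall j, `|t 0 j - thstar 0 j| < rho) -> closure Theta t.
Hypotheses (hpen0 : pen 0 = 0) (hpen_ge0 : forall y, 0 <= pen y) (hq : 0 < q).
Hypotheses (hK : 1 <= K) (hK2 : K <= K2) (hRad : n%:R * K2 <= Rad).
Hypotheses (he : 0 < e <= 1) (herho : e * K2 < rho).
Hypotheses (hx : forall j, 0 < x j) (ha : forall j, a j != 0).
Hypothesis hae : forall j, `|a j| <= e.
Hypothesis hJ0 : forall j, thstar 0 j = 0 -> x j `^ (- q^-1) / `|a j| <= e.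
Hypothesis hut : forall j, `|ut j| <= K.
Hypotheses (hD : forall j, `|D 0 j| <= K) (hG : forall i j, `|G i j| <= K).
Hypothesis hr : forall u, closure Theta (thstar + u *m adiag) -> enorm u <= Rad ->
  `|rr u| <= e.
Hypothesis hmax : forall t, closure Theta t ->
  Hf t - \sum_j x j * pen (t 0 j) <= Hf th - \sum_j x j * pen (th 0 j).
Hypothesis hlaq : forall u, closure Theta (thstar + u *m adiag) ->
  Hf (thstar + u *m adiag) - Hf thstar = laq D G u + rr u.

(** The 2 stands for two remainders of size [e]; the rest is the constant of [laq_lipschitz] for
    points at distance at most [K * e]. *)
Let C0 := 2 + (n%:R * K + (n * n)%:R * K ^+ 2) * K.

Lemma local_coordE u j : (thstar + u *m adiag) 0 j = thstar 0 j + u 0 j * a j.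
Proof. by rewrite mxE mul_mx_diag !mxE. Qed.

Lemma local_thE : th = thstar + v *m adiag.
Proof. by apply/rowP => j; rewrite local_coordE mxE divfK// addrC subrK. Qed.

(** The two scalings of a null coordinate differ by the ratio of rates that [A6] makes small. *)
Lemma local_bound0 j : thstar 0 j = 0 -> `|v 0 j| <= K * e.
Proof.
move=> t0; have xq : x j `^ (- q^-1) != 0 by rewrite gt_eqF ?powR_gt0.
have -> : v 0 j = ut j * (x j `^ (- q^-1) / a j).
  by rewrite mxE /ut t0 eqxx mulrA divfK.
rewrite normrM; apply: ler_pM => //.
by rewrite normrM normfV ger0_norm ?powR_ge0//; exact: hJ0.
Qed.

Lemma local_bound j : `|v 0 j| <= K.
Proof.
have [t0|t0] := eqVneq (thstar 0 j) 0; last first.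
  by have := hut j; rewrite /ut (negbTE t0) mxE.
apply: (le_trans (local_bound0 t0)); rewrite ler_piMr ?(le_trans ler01)//.
by case/andP: he.
Qed.

Lemma local_adm (u : 'rV[R]_n) : (forall j, `|u 0 j| <= K2) ->
  closure Theta (thstar + u *m adiag).
Proof.
move=> hu; apply: hball => j; rewrite local_coordE addrC addKr normrM.
by apply: le_lt_trans herho; rewrite mulrC; apply: ler_pM.
Qed.

Lemma local_rem (u : 'rV[R]_n) : (forall j, `|u 0 j| <= K2) -> `|rr u| <= e.
Proof.
move=> hu; apply: hr; first exact: local_adm.
apply: le_trans hRad; rewrite enormE; apply: enorm_on_le => //.
by apply: le_trans hK2; exact: le_trans hK.
Qed.

(** Both [u] and [v] lie in the box of size [K2], hence are admissible, and expanding the criterion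
    at both costs two remainders of size [e]. *)
Lemma local_compare (u : 'rV[R]_n) : (forall j, `|u 0 j| <= K2) ->
  laq D G u - laq D G v <=
  2 * e + \sum_j x j * (pen (thstar 0 j + u 0 j * a j) - pen (th 0 j)).
Proof.
move=> hu; have hv j : `|v 0 j| <= K2 := le_trans (local_bound j) hK2.
have := hmax (local_adm hu).
have Eu := hlaq (local_adm hu); have Ev := hlaq (local_adm hv).
rewrite -local_thE in Ev.
have -> : \sum_j x j * (pen (thstar 0 j + u 0 j * a j) - pen (th 0 j)) =
    \sum_j x j * pen ((thstar + u *m adiag) 0 j) - \sum_j x j * pen (th 0 j).
  by rewrite -sumrB; apply: eq_bigr => j _; rewrite local_coordE mulrBr.
have := local_rem hu; have := local_rem hv.
rewrite !ler_norml => /andP[? ?] /andP[? ?].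
by move: Eu Ev; lra.
Qed.

Let vJ := v *m (selmx J1)^T *m selmx J1.

Lemma local_vJE j : vJ 0 j = if thstar 0 j == 0 then 0 else v 0 j.
Proof. by rewrite selmx_proj inE; case: eqP. Qed.

Lemma local_vJ_bound j : `|vJ 0 j| <= K.
Proof.
rewrite local_vJE; case: ifP => _; last exact: local_bound.
by rewrite normr0; exact: le_trans hK.
Qed.

Lemma local_vJ_laq : `|laq D G v - laq D G vJ| <= (C0 - 2) * e.
Proof.
have -> : (C0 - 2) * e = (n%:R * K + (n * n)%:R * K ^+ 2) * (K * e).
  by rewrite /C0; ring.
apply: laq_lipschitz => //; [exact: local_bound|exact: local_vJ_bound|].
move=> j; rewrite local_vJE; case: eqP => [/local_bound0|_]; first by rewrite subr0.
rewrite subrr normr0 mulr_ge0//; first exact: le_trans hK.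
by case/andP: he => /ltW.
Qed.

(** Against the competitor [vJ], the penalty saved on a null coordinate is at most the loss in the
    quadratic criterion plus the remainders. *)
Lemma local_null (lam dlam : R) j :
  (forall y, `|y| < dlam -> lam * `|y| `^ q <= pen y) -> e * K < dlam ->
  thstar 0 j = 0 -> lam * `|ut j| `^ q <= C0 * e.
Proof.
move=> hlam ed t0.
have e0 : 0 <= e by case/andP: he => /ltW.
have K0 : 0 <= K by exact: le_trans hK.
have xpen : x j * pen (th 0 j) <= C0 * e.
  have := local_compare (fun j => le_trans (local_vJ_bound j) hK2).
  (* On nonnull coordinates the competitor agrees with [th] and the penalties cancel; the other null
     coordinates only lower the sum. *)
  have : \sum_j x j * (pen (thstar 0 j + vJ 0 j * a j) - pen (th 0 j))
      <= - (x j * pen (th 0 j)).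
    rewrite (bigD1 j)//= local_vJE t0 eqxx mul0r addr0 hpen0 sub0r mulrN gerDl.
    apply: sumr_le0 => i _; rewrite local_vJE.
    case: eqP => [ti|_].
      by rewrite ti mul0r addr0 hpen0 sub0r mulrN oppr_le0 mulr_ge0 // ltW.
    by rewrite -(local_coordE v) -local_thE subrr mulr0.
  by have := local_vJ_laq; rewrite ler_norml => /andP[? ?]; lra.
apply: le_trans xpen.
have thut : th 0 j = ut j * x j `^ (- q^-1).
  by rewrite /ut t0 eqxx subr0 divfK// gt_eqF ?powR_gt0.
(* The exponent [- q^-1] in the rate is exactly what cancels the weight [x j] here. *)
have <- : x j * (lam * `|th 0 j| `^ q) = lam * `|ut j| `^ q.
  rewrite thut normrM (ger0_norm (powR_ge0 _ _)) powRM ?powR_ge0// -powRrM.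
  rewrite mulNr mulVf ?gt_eqF// powR_inv1 ?ltW// mulrCA; congr (_ * _).
  by rewrite mulrCA divff ?mulr1 ?gt_eqF.
rewrite ler_pM2l//; apply: hlam; apply: le_lt_trans ed.
rewrite {1}local_thE local_coordE t0 add0r normrM mulrC.
by apply: ler_pM => //; exact: local_bound.
Qed.

(** Coercivity turns the gap of [laq_gap] into a squared distance, and the leading factor 2 undoes
    the one half there. The gap is bounded by comparison with the maximizer extended by zero. *)
Lemma local_nonnull (psi : 'rV[R]_n) (err c : R) : 0 < c -> coercive G c ->
  (forall i, `|laq_sol J1 psi (D, G) 0 i| <= K2) ->
  (forall j t, thstar 0 j != 0 -> `|t| <= K2 ->
     `|x j * (pen (thstar 0 j + t * a j) - pen (thstar 0 j)) - psi 0 j * t| <= err) ->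
  0 <= err ->
  c * \sum_i ((v *m (selmx J1)^T) 0 i - laq_sol J1 psi (D, G) 0 i) ^+ 2
    <= 2 * (C0 * e + 2 * n%:R * err).
Proof.
move=> c0 hc hh herr err0.
have := laq_gap psi (z := (D, G)) (v *m (selmx J1)^T) (coercive_det J1 c0 hc).
set h := laq_sol J1 psi (D, G) in hh *; rewrite /= -/vJ.
set u := h *m selmx J1 => gap.
have uK j : `|u 0 j| <= K2.
  have [jJ|jJ] := boolP (j \in J1).
    by rewrite -(enum_rankK_in jJ jJ) selmx_in.
  rewrite selmx_out// normr0; apply: le_trans hK2; exact: le_trans hK.
have cmp := local_compare uK.
(* A nonnull coordinate is linearized at both points, which costs [2 * err]; on a null one the
   competitor pays no penalty and both linear terms vanish. *)
have sumle : \sum_j x j * (pen (thstar 0 j + u 0 j * a j) - pen (th 0 j)) <=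
    (psi *m u^T) 0 0 - (psi *m vJ^T) 0 0 + 2 * n%:R * err.
  rewrite !mul_trmxE -sumrB -mulrA mulrCA -[n in n%:R]card_ord mulr_natl -sumr_const.
  rewrite -big_split/=; apply: ler_sum => j _; rewrite local_vJE.
  have [t0|t0] := eqVneq (thstar 0 j) 0.
    have -> : u 0 j = 0 by apply: selmx_out; rewrite inE t0 eqxx.
    rewrite t0 mul0r add0r hpen0 sub0r !mulr0 subrr add0r.
    apply: (@le_trans _ _ 0); last by rewrite mulr_ge0.
    by rewrite mulrN oppr_le0 mulr_ge0 // ltW.
  have := herr j _ t0 (uK j).
  have := herr j _ t0 (le_trans (local_bound j) hK2).
  rewrite -(local_coordE v) -local_thE !ler_norml => /andP[? ?] /andP[? ?].
  by lra.
have cc := hc ((v *m (selmx J1)^T - h) *m selmx J1).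
rewrite sumsq_selmx in cc.
have -> : \sum_i ((v *m (selmx J1)^T) 0 i - h 0 i) ^+ 2 =
    \sum_i (v *m (selmx J1)^T - h) 0 i ^+ 2.
  by apply: eq_bigr => i _; rewrite [in RHS]mxE [(- h) 0 i]mxE.
apply: (le_trans cc).
have laqB w : laq (D - psi) G w = laq D G w - (psi *m w^T) 0 0.
  have mxB (M N : 'M[R]_1) : (M - N) 0 0 = M 0 0 - N 0 0 by rewrite !mxE.
  by rewrite /laq mulmxBl mxB addrAC.
have := local_vJ_laq; rewrite ler_norml => /andP[? ?].
by move: gap cmp; rewrite !laqB; lra.
Qed.

End Localization.

(** * Expectations and events of small probability *)

Section Expectation.
Context {R : realType} {d : measure_display} {Omega : measurableType d}.
Variable P : probability Omega R.
Implicit Types (f g : Omega -> R) (TT : set R).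

Lemma bounded_integrable f (M : R) : measurable_fun setT f ->
  (forall w, `|f w| <= M) -> P.-integrable setT (EFin \o f).
Proof.
move=> mf hf; apply: measurable_bounded_integrable => //.
  by rewrite -ge0_fin_numE//; exact: fin_num_measure.
exists M; split; first exact: num_real.
by move=> y My w _; exact: le_trans (hf w) (ltW My).
Qed.

(** [B] is an exceptional event: outside it the functions compare up to [eta], and on it an extra
    cost [k] is allowed. *)
Lemma expectation_le f g (B : set Omega) (M eta k : R) :
  measurable_fun setT f -> measurable_fun setT g -> measurable B ->
  (forall w, `|f w| <= M) -> (forall w, `|g w| <= M) ->
  (forall w, f w <= g w + eta + k * \1_B w) ->
  fine (\int[P]_w (f w)%:E) <= fine (\int[P]_w (g w)%:E) + eta + k * fine (P B).
Proof.
move=> mf mg mB fM gM fg.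
have intf := bounded_integrable mf fM; have intg := bounded_integrable mg gM.
have intc : P.-integrable setT (EFin \o (fun=> eta)).
  by apply: (@bounded_integrable _ `|eta|).
have mI : measurable_fun setT (fun w => k * \1_B w : R).
  by apply: measurable_funM => //; exact: measurable_indic.
have intB : P.-integrable setT (EFin \o (fun w => k * \1_B w)).
  apply: (@bounded_integrable _ `|k|) => // w.
  by rewrite normrM ler_piMr// indicE; case: (_ \in _); rewrite ?normr1 ?normr0.
have intge : P.-integrable setT (EFin \o (fun w => g w + eta)).
  apply: (@bounded_integrable _ (M + `|eta|)); first exact: measurable_funD.
  by move=> w; rewrite (le_trans (ler_normD _ _))// lerD2r.
have -> : fine (\int[P]_w (g w)%:E) + eta + k * fine (P B) =
    Rintegral P setT (fun w => g w + eta + k * \1_B w).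
  rewrite RintegralD// RintegralD//; congr (_ + _ + _).
    rewrite Rintegral_cst// [X in fine X](_ : _ = 1%E) ?mulr1//.
    exact: probability_setT.
  rewrite RintegralZl//; last first.
    apply: (@bounded_integrable _ 1); first exact: measurable_indic.
    by move=> w; rewrite indicE; case: (_ \in _); rewrite ?normr1 ?normr0.
  by congr (_ * _); rewrite /Rintegral integral_indic// setIT.
apply: le_Rintegral => //.
apply: (@bounded_integrable _ (M + `|eta| + `|k|)).
  by apply: measurable_funD => //; exact: measurable_funD.
move=> w; rewrite (le_trans (ler_normD _ _))// lerD//.
  by rewrite (le_trans (ler_normD _ _))// lerD2r.
by rewrite normrM ler_piMr// indicE; case: (_ \in _); rewrite ?normr1 ?normr0.
Qed.

Lemma probability_lt (A : set Omega) (e : R) : measurable A ->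
  (P A < e%:E)%E = (fine (P A) < e).
Proof. by move=> mA; rewrite -lte_fin fineK//; exact: fin_num_measure. Qed.

Lemma vanishing_prob (F : nat -> set Omega) (e : R) :
  (forall k, measurable (F k)) -> (forall k, F k.+1 `<=` F k) ->
  \bigcap_k F k = set0 -> 0 < e -> exists k, fine (P (F k)) < e.
Proof.
move=> mF dF F0 e0.
have : P \o F @ \oo --> P (\bigcap_k F k).
  apply: nonincreasing_cvg_mu => //.
  - by rewrite -ge0_fin_numE//; exact: fin_num_measure.
  - exact: bigcapT_measurable.
  - by apply/nonincreasing_seqP => k; apply/subsetPset.
rewrite F0 measure0 => /fine_cvgP[_ /cvgrPdist_lt/(_ _ e0)[N _ /(_ N)/= h]].
exists N; have := h (leqnn _); rewrite sub0r normrN.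
exact: le_lt_trans (ler_norm _).
Qed.

(** Measurability is packed with the bound because subadditivity and monotonicity of [P] require
    it. *)
Definition eventually_small TT (A : R -> set Omega) (e : R) : Prop :=
  exists T0, forall T, TT T -> T0 <= T -> measurable (A T) /\ fine (P (A T)) < e.

Lemma eventually_smallU TT A B e1 e2 : eventually_small TT A e1 ->
  eventually_small TT B e2 ->
  eventually_small TT (fun T => A T `|` B T) (e1 + e2).
Proof.
move=> [T1 h1] [T2 h2]; exists (Num.max T1 T2) => T TT_T.
rewrite ge_max => /andP[le1 le2].
have [mA PA] := h1 _ TT_T le1; have [mB PB] := h2 _ TT_T le2.
have mU := measurableU _ _ mA mB; split=> //; rewrite -probability_lt//.
apply: (le_lt_trans (measureU2 P mA mB)).
rewrite -(fineK (fin_num_measure P _ mA)) -(fineK (fin_num_measure P _ mB)).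
by rewrite -EFinD lte_fin ltrD.
Qed.

Lemma eventually_small_bigU TT (I : finType) (A : I -> R -> set Omega) :
  (forall i e, 0 < e -> eventually_small TT (A i) e) ->
  forall e, 0 < e -> eventually_small TT (fun T => \big[setU/set0]_i A i T) e.
Proof.
move=> hA; elim: (index_enum I) => [|i s IH] e e0.
  by exists 0 => T _ _; rewrite big_nil measure0.
have e2 : 0 < e / 2 by rewrite divr_gt0.
have [T0 h] := eventually_smallU (hA i _ e2) (IH _ e2).
by exists T0 => T TT_T le_T; rewrite big_cons (splitr e); exact: h.
Qed.

Lemma lim_along_eventually_small TT (A : R -> set Omega) e :
  (forall T, TT T -> measurable (A T)) ->
  lim_along TT (fun T => fine (P (A T))) 0 -> 0 < e -> eventually_small TT A e.
Proof.
move=> mA lA e0; have [T0 h] := lA e e0; exists T0 => T TT_T le_T.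
split; first exact: mA.
by have := h _ TT_T le_T; rewrite subr0; exact: le_lt_trans (ler_norm _).
Qed.

End Expectation.

(** The four quarters of [e] are spent on the continuity of the test function, on the convergence
    for the smoothed test function, and on two exceptional events. *)
Lemma ler_eps_chain {R : realType} (a b c d x y e : R) :
  a <= b + e / 4 + x -> c <= d + 0 + y -> b - c < e / 4 ->
  x <= e / 4 -> y <= e / 4 -> a <= d + e.
Proof. lra. Qed.

(** * Convergence in distribution: tails, one-sided criterion, uniform continuity *)

Section WeakConvergence.
Context {R : realType} {d : measure_display} {Omega : measurableType d}.
Variables (P : probability Omega R) (TT : set R).

(** This is the truncation of [y] to the unit interval; with absolute values its continuity reduces
    to that of the norm. *)
Definition clamp01 (y : R) : R := (`|y| - `|y - 1| + 1) / 2.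

Lemma clamp01_itv y : 0 <= clamp01 y <= 1.
Proof. by rewrite /clamp01; case: (ger0P y); case: (ger0P (y - 1)); lra. Qed.

Lemma clamp01_eq0 y : y <= 0 -> clamp01 y = 0.
Proof. by rewrite /clamp01; case: (ger0P y); case: (ger0P (y - 1)); lra. Qed.

Lemma clamp01_eq1 y : 1 <= y -> clamp01 y = 1.
Proof. by rewrite /clamp01; case: (ger0P y); case: (ger0P (y - 1)); lra. Qed.

Lemma continuous_at_clamp01 (V : topologicalType) (x : V) (f : V -> R) :
  {for x, continuous f} -> {for x, continuous (fun v => clamp01 (f v))}.
Proof.
move=> cf; apply: continuous_atM; last exact: continuous_at_cst.
apply: continuous_atD; last exact: continuous_at_cst.
apply: continuous_atB; first exact: continuous_at_norm.
apply: continuous_at_norm; apply: continuous_atB => //.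
exact: continuous_at_cst.
Qed.

(** The cutoff [h] lies between the indicators of [g] exceeding [k + 1] and of [g] exceeding [k].
    Its expectation under the limit is small by the choice of [k], and convergence transfers this to
    [X T]. *)
Lemma cvg_dist_tail (V : topologicalType) (X : R -> Omega -> V) (Z : Omega -> V)
    (g : V -> R) (e : R) :
  cvg_dist P TT X Z -> continuous g ->
  (forall T (h : V -> R), TT T -> continuous h -> measurable_fun setT (h \o X T)) ->
  (forall h : V -> R, continuous h -> measurable_fun setT (h \o Z)) -> 0 < e ->
  exists2 K : R, 1 <= K & forall K', K <= K' ->
    eventually_small P TT (fun T => [set w | K' < g (X T w)]) e.
Proof.
move=> XZ cg mX mZ e0.
have e2 : 0 < e / 2 by rewrite divr_gt0.
have mF k : measurable [set w | k%:R < g (Z w)].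
  by apply: measurable_set_lt => //; exact: mZ.
have [k Pk] : exists k, fine (P [set w | k%:R < g (Z w)]) < e / 2.
  apply: vanishing_prob => //.
    by move=> k w /=; apply: lt_trans; rewrite ltr_nat.
  apply/seteqP; split=> // w h.
  have := h (Num.truncn (g (Z w))).+1 I; rewrite /= => /lt_trans/(_ (truncnS_gt _)).
  by rewrite ltxx.
exists (k%:R + 1); first by rewrite lerDr.
move=> K kK; pose h v := clamp01 (g v - k%:R).
have ch : continuous (fun v => clamp01 (g v - k%:R)).
  move=> v; apply: (@continuous_at_clamp01 V v (fun v => g v - k%:R)).
  apply: continuous_atB; first exact: cg.
  exact: continuous_at_cst.
have h01 v : `|h v| <= 1.
  by have /andP[? ?] := clamp01_itv (g v - k%:R); rewrite ger0_norm.
have [T0 hT0] := XZ h ch (ex_intro _ 1 h01) _ e2.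
exists T0 => T TT_T le_T.
have mA : measurable [set w | K < g (X T w)].
  by apply: measurable_set_lt => //; exact: mX.
split => //.
have hZ : fine (\int[P]_w (h (Z w))%:E) < e / 2.
  have ptw w : (h \o Z) w <= 0 + 0 + 1 * \1_[set w | k%:R < g (Z w)] w.
    rewrite !add0r mul1r indicE/=.
    case: (boolP (w \in _)) => [_|]; first by case/andP: (clamp01_itv (g (Z w) - k%:R)).
    move=> /negP; rewrite inE/= => /negP; rewrite -leNgt => gk.
    by rewrite /h clamp01_eq0// subr_le0.
  have m0 : measurable_fun setT (fun _ : Omega => 0 : R) by [].
  have n0 (w : Omega) : `|0 : R| <= 1 by rewrite normr0.
  have := @expectation_le _ _ _ P _ (fun=> 0) _ _ _ _ (mZ h ch) m0 (mF k)
    (fun w => h01 (Z w)) n0 ptw.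
  rewrite addr0 mul1r => /le_lt_trans; apply.
  by rewrite integral0 add0r.
have hX : fine (P [set w | K < g (X T w)]) <= fine (\int[P]_w (h (X T w))%:E).
  pose A := [set w | K < g (X T w)].
  have mI : measurable_fun setT (\1_A : Omega -> R) by exact: measurable_indic.
  have I1 w : `|\1_A w : R| <= 1.
    by rewrite indicE; case: (_ \in _); rewrite ?normr1 ?normr0.
  have ptw w : \1_A w <= (h \o X T) w + 0 + 0 * \1_set0 w.
    rewrite addr0 mul0r addr0 indicE/=.
    case: (boolP (w \in _)) => [|_].
      rewrite inE/= => gK; rewrite /h clamp01_eq1//.
      by rewrite lerBrDl (le_trans kK)// ltW.
    by case/andP: (clamp01_itv (g (X T w) - k%:R)).
  have := @expectation_le _ _ _ P _ _ _ _ _ _ mI (mX T h TT_T ch) measurable0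
    I1 (fun w => h01 (X T w)) ptw.
  by rewrite addr0 mul0r addr0 integral_indic// setIT.
apply: (le_lt_trans hX).
have := hT0 _ TT_T le_T; rewrite ltr_norml => /andP[_].
by rewrite (splitr e); lra.
Qed.

(* Applying the one-sided bound to [- f] gives the other inequality. *)
Lemma cvg_dist_upper (V : topologicalType) (X : R -> Omega -> V) (Z : Omega -> V) :
  (forall f : V -> R, continuous f -> (exists M : R, forall v, `|f v| <= M) ->
    forall e, 0 < e -> exists T0, forall T, TT T -> T0 <= T ->
      fine (\int[P]_w (f (X T w))%:E) <= fine (\int[P]_w (f (Z w))%:E) + e) ->
  (forall T (h : V -> R), TT T -> continuous h -> measurable_fun setT (h \o X T)) ->
  (forall h : V -> R, continuous h -> measurable_fun setT (h \o Z)) ->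
  cvg_dist P TT X Z.
Proof.
move=> ub mX mZ f cf [M fM] e e0.
have cNf : continuous (fun v => - f v) by move=> v; apply: cvgN; exact: cf.
have NfM v : `|- f v| <= M by rewrite normrN.
have e2 : 0 < e / 2 by rewrite divr_gt0.
have [T1 h1] := ub f cf (ex_intro _ M fM) _ e2.
have [T2 h2] := ub _ cNf (ex_intro _ M NfM) _ e2.
exists (Num.max T1 T2) => T TT_T; rewrite ge_max => /andP[le1 le2].
have intN (Y : Omega -> V) : measurable_fun setT (f \o Y) ->
    fine (\int[P]_w (- f (Y w))%:E) = - fine (\int[P]_w (f (Y w))%:E).
  move=> mY; have iY := bounded_integrable P mY (fun w => fM (Y w)).
  rewrite (_ : (fun w => (- f (Y w))%:E) = (fun w => (- (f (Y w))%:E)%E))//.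
  by rewrite integralN ?fineN//; exact: integrable_add_def.
have := h1 _ TT_T le1; have := h2 _ TT_T le2.
rewrite !intN ?ltr_norml; [|exact: mZ|exact: mX].
by move=> ? ?; apply/andP; split; lra.
Qed.

(** Only [x] is confined to the compact box, since it will be applied with [y] the quadratic
    maximizer, whose bound is larger. *)
Lemma uniformly_continuous_box n (f : 'rV[R]_n -> R) (K eta : R) :
  continuous f -> 0 < eta -> exists2 dl, 0 < dl & forall x y : 'rV[R]_n,
    (forall i, `|x 0 i| <= K) -> (forall i, `|x 0 i - y 0 i| < dl) ->
    `|f x - f y| < eta.
Proof.
move=> cf eta0.
have /compact_near_coveringP/(_ _ (0 : R)^'+
    (fun dl x => forall y, ball x dl y -> `|f x - f y| < eta)) := @box_compact R n K.
case=> [x _|dl0 /= dl00 hdl]; last first.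
  have dl2 : 0 < dl0 / 2 by rewrite divr_gt0.
  exists (dl0 / 2) => // x y xK xy; apply: (hdl (dl0 / 2)) => //.
    by rewrite /= sub0r normrN gtr0_norm// ltr_pdivrMr// ltr_pMr// ltr1n.
  by split => // i j; rewrite (ord1 i); exact: xy.
have /cvg_ballP/(_ (eta / 2)) := cf x; rewrite divr_gt0// => /(_ isT).
move=> /nbhs_ballP[r /= r0 hr].
have r2 : 0 < r / 2 by rewrite divr_gt0.
(* Half radii keep both [x'] and any [y] close to [x'] within [r] of the centre [x]. *)
exists (ball x (r / 2), [set dl | dl < r / 2]).
  by split; [exact: nbhsx_ballx|exact: nbhs_right_lt].
move=> [x' dl] /= [bx' ldl] y by_.
have h1 : ball (f x) (eta / 2) (f x').
  by apply: hr; apply: le_ball bx'; rewrite ler_pdivrMr// ler_pMr// ler1n.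
have h2 : ball (f x) (eta / 2) (f y).
  apply: hr; rewrite (splitr r); apply: (ball_triangle bx').
  exact: le_ball (ltW ldl) _ by_.
by have := ball_splitr h1 h2.
Qed.

End WeakConvergence.

(** * The penalty near zero and away from zero *)

Section Penalty.
Context {R : realType}.

(** Smallness conditions on [e] are stated as neighbourhood properties, so that finitely many of
    them hold at once. *)
Lemma near_right0_mul_lt (C b : R) : 0 < b -> \forall e \near (0 : R)^'+, C * e < b.
Proof.
move=> b0; have C1 : 0 < `|C| + 1 by rewrite ltr_wpDl.
have bC : 0 < b / (`|C| + 1) by rewrite divr_gt0.
near=> e.
have e0 : 0 < e by near: e; exact: nbhs_right_gt.
have : e < b / (`|C| + 1) by near: e; exact: nbhs_right_lt.
rewrite ltr_pdivlMr// mulrDr mulr1 mulrC => h.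
apply: le_lt_trans h; apply: (@le_trans _ _ (`|C| * e)).
  by rewrite ler_pM2r// ler_norm.
by rewrite lerDl ltW.
Unshelve. all: by end_near. Qed.

Lemma near_right0_ex (Q : R -> Prop) :
  (\forall e \near (0 : R)^'+, Q e) -> exists2 e, 0 < e & Q e.
Proof.
move=> hQ; near (0 : R)^'+ => e; exists e.
  by near: e; exact: nbhs_right_gt.
by near: e.
Unshelve. all: by end_near. Qed.

Lemma derive1_approx (f : R -> R) (y eps : R) : derivable f y 1 -> 0 < eps ->
  exists2 dl, 0 < dl &
    forall h, `|h| < dl -> `|f (y + h) - f y - derive1 f y * h| <= eps * `|h|.
Proof.
move=> df eps0.
have : h^-1 *: ((f \o shift y) (h *: 1) - f y) @[h --> 0^'] --> derive1 f y.
  by rewrite derive1E; exact: df.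
move=> /cvgrPdist_lt/(_ _ eps0)[dl /= dl0 hdl]; exists dl => // h hh.
have [->|h0] := eqVneq h 0; first by rewrite addr0 subrr mulr0 subr0 normr0 mulr0.
have := hdl h; rewrite /= sub0r normrN => /(_ hh h0) /ltW.
have -> : derive1 f y - h^-1 *: (f (h *: 1 + y) - f y) =
    - ((f (y + h) - f y - derive1 f y * h) / h).
  rewrite /GRing.scale/= mulr1 [h + y]addrC mulrBl [_ * h / h]mulrK ?unitfE//.
  by rewrite opprB mulrC.
by rewrite normrN normrM normfV ler_pdivrMr ?normr_gt0.
Qed.

(** The error is the first-order Taylor remainder times [x], plus the error in [x * a] times the
    derivative. The former is small although [x] is unbounded, because [x * a] stays within 1 of
    [b]. *)
Lemma penalty_linearization (pen : R -> R) (y b K err : R) : derivable pen y 1 ->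
  0 < K -> 0 < err ->
  \forall e \near (0 : R)^'+, forall x a t, 0 < x -> `|a| <= e -> `|t| <= K ->
    `|x * a - b| <= e ->
    `|x * (pen (y + t * a) - pen y) - b * derive1 pen y * t| <= err.
Proof.
move=> dp K0 err0.
have b1 : 0 < (`|b| + 1) * K by rewrite mulr_gt0// ltr_wpDl.
have eps0 : 0 < err / 2 / ((`|b| + 1) * K) by rewrite !divr_gt0.
have [dl dl0 hdl] := derive1_approx dp eps0.
near=> e => x a t x0 ae tK xab.
have e1 : 1 * e < 1 by near: e; exact: near_right0_mul_lt.
have eK : K * e < dl by near: e; exact: near_right0_mul_lt.
have eD : `|derive1 pen y| * K * e < err / 2.
  by near: e; apply: near_right0_mul_lt; rewrite divr_gt0.
rewrite mul1r in e1.
have ta : `|t * a| < dl by rewrite normrM; apply: le_lt_trans eK; exact: ler_pM.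
have xa : x * `|a| <= `|b| + 1.
  rewrite -{1}(gtr0_norm x0) -normrM -[x * a](subrK b) addrC.
  by apply: (le_trans (ler_normD _ _)); rewrite lerD2l (le_trans xab)// ltW.
have -> : x * (pen (y + t * a) - pen y) - b * derive1 pen y * t =
    x * (pen (y + t * a) - pen y - derive1 pen y * (t * a)) +
    (x * a - b) * (derive1 pen y * t) by ring.
apply: (le_trans (ler_normD _ _)); rewrite [leRHS]splitr lerD//.
  rewrite normrM gtr0_norm//.
  apply: (@le_trans _ _ (x * (err / 2 / ((`|b| + 1) * K) * `|t * a|))).
    by rewrite ler_pM2l//; exact: hdl.
  rewrite normrM mulrCA -[leRHS](divfK (lt0r_neq0 b1)).
  rewrite ler_pM2l// mulrCA mulrC; apply: ler_pM => //.
  by rewrite mulr_ge0 // ltW.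
rewrite normrM; apply: le_trans (ltW eD); rewrite mulrC; apply: ler_pM => //.
by rewrite normrM; exact: ler_pM.
Unshelve. all: by end_near. Qed.

Lemma penalty_linearization_all n (pen : R -> R) (y b : 'I_n -> R) (K err : R) :
  (forall z, z != 0 -> derivable pen z 1) -> 0 < K -> 0 < err ->
  \forall e \near (0 : R)^'+, forall j, y j != 0 ->
    forall x a t, 0 < x -> `|a| <= e -> `|t| <= K -> `|x * a - b j| <= e ->
    `|x * (pen (y j + t * a) - pen (y j)) - b j * derive1 pen (y j) * t| <= err.
Proof.
move=> dpen K0 err0; apply: filter_forall => j.
have [y0|y0] := eqVneq (y j) 0; first exact: nearW.
by apply: filterS (penalty_linearization (b j) (dpen _ y0) K0 err0) => e h _.
Qed.

(** Near 0 the ratio exceeds half its limit; at 0 itself, excluded from the limit, both sides vanish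
    because [q] is positive. *)
Lemma penalty_lower_bound (pen : R -> R) (q lam : R) : 0 < q ->
  (forall x, 0 <= pen x) -> 0 < lam -> (pen x / (`|x| `^ q)) @[x --> 0^'] --> lam ->
  exists2 dl, 0 < dl & forall y, `|y| < dl -> lam / 2 * `|y| `^ q <= pen y.
Proof.
move=> q0 pen0 lam0 /cvgrPdist_lt/(_ (lam / 2)); rewrite divr_gt0// => /(_ isT).
move=> [dl /= dl0 hdl]; exists dl => // y hy.
have [->|y0] := eqVneq y 0.
  by rewrite normr0 powR0 ?mulr0 ?gt_eqF.
have := hdl y; rewrite /= sub0r normrN => /(_ hy y0).
rewrite ltr_norml => /andP[_ h].
have yq : 0 < `|y| `^ q by rewrite powR_gt0// normr_gt0.
by rewrite -ler_pdivlMr//; lra.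
Qed.

End Penalty.

(** * Measurability of norms, inverse matrices and the remainder event *)

Section FieldMeasurability.
Context {R : realType} {d : measure_display} {Omega : measurableType d} {n : nat}.

Lemma measurable_enorm_on (J : {set 'I_n}) (X : Omega -> 'rV[R]_n) :
  (forall j, measurable_fun setT (fun w => X w 0 j)) ->
  measurable_fun setT (fun w => enorm_on J (X w)).
Proof.
move=> mX.
have -> : (fun w => enorm_on J (X w)) =
    (fun w => (\sum_(j in J) X w 0 j ^+ 2) `^ 2^-1).
  apply/funext => w; rewrite powR12_sqrt//.
  by apply: sumr_ge0 => j _; exact: sqr_ge0.
apply: (measurableT_comp (@measurable_powR R 2^-1)).
have := @falg_sum R Omega (fun f => measurable_fun setT f).
apply => //; first by move=> f g; exact: measurable_funD.
by move=> j; exact: measurable_funX.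
Qed.

Lemma measurable_det k (A : Omega -> 'M[R]_k) :
  (forall i j, measurable_fun setT (fun w => A w i j)) ->
  measurable_fun setT (fun w => \det (A w)).
Proof.
apply: (@falg_det R Omega (fun f => measurable_fun setT f)) => //.
- by move=> f g; exact: measurable_funD.
- by move=> f g; exact: measurable_funM.
Qed.

(** [invmx] returns a singular matrix unchanged, so the entries are given piecewise on a measurable
    partition. *)
Lemma measurable_invmx k (A : Omega -> 'M[R]_k) :
  (forall i j, measurable_fun setT (fun w => A w i j)) ->
  forall i j, measurable_fun setT (fun w => invmx (A w) i j).
Proof.
move=> mA i j; have mdet := measurable_det mA.
rewrite (_ : (fun _ => _) = (fun w => if \det (A w) == 0 then A w i j
    else (\det (A w))^-1 * \adj (A w) i j)); last first.
  apply/funext => w; rewrite /invmx unitmxE unitfE.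
  by case: eqP => //= _; rewrite mxE.
apply: measurable_fun_ifT => //; first exact: measurable_fun_eqr.
apply: measurable_funM; first exact: measurable_invr.
apply: (@falg_adj R Omega (fun f => measurable_fun setT f)) => //.
- by move=> f g; exact: measurable_funD.
- by move=> f g; exact: measurable_funM.
Qed.

Lemma near_ball_ex (V : pseudoMetricType R) (u : V) (Q : V -> Prop) :
  (\forall v \near u, Q v) -> exists2 dl, 0 < dl & forall v, ball u dl v -> Q v.
Proof. by move=> /nbhs_ballP[dl /= dl0 hdl]; exists dl. Qed.

Lemma laq_continuous (D : 'rV[R]_n) (G : 'M[R]_n) : continuous (laq D G).
Proof.
move=> u.
rewrite (_ : laq D G = fun u => \sum_j D 0 j * u 0 j - 2^-1 * qform G u); last first.
  by apply/funext => v; rewrite /laq mul_trmxE.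
apply: (@continuous_atB R _ u (fun u : 'rV[R]_n => \sum_j D 0 j * u 0 j)
  (fun u => 2^-1 * qform G u)).
  apply: continuous_at_sum => j; apply: continuous_atM.
    exact: continuous_at_cst.
  exact: coord_continuous.
apply: continuous_atM; first exact: continuous_at_cst.
exact: qform_continuous.
Qed.

Lemma measurable_laq (D : Omega -> 'rV[R]_n) (G : Omega -> 'M[R]_n) u :
  (forall j, measurable_fun setT (fun w => D w 0 j)) ->
  (forall i j, measurable_fun setT (fun w => G w i j)) ->
  measurable_fun setT (fun w => laq (D w) (G w) u).
Proof.
move=> mD mG.
rewrite (_ : (fun _ => _) = (fun w => \sum_j D w 0 j * u 0 j -
    2^-1 * \sum_i \sum_j G w i j * (u 0 i * u 0 j))); last first.
  by apply/funext => w; rewrite /laq mul_trmxE qformE.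
apply: measurable_funB.
  by apply: measurable_sum => j; apply: measurable_funM.
apply: measurable_funM => //; apply: measurable_sum => i.
by apply: measurable_sum => j; apply: measurable_funM.
Qed.

(** Nothing is assumed on the regularity of [r], but at admissible points the expansion expresses it
    through [Hf] and [laq], which are measurable in [w] and continuous in [u];
    [measurable_exists_gt] then applies. *)
Lemma measurable_remainder_exceeds (Theta : set 'rV[R]_n) (thstar : 'rV[R]_n)
    (A : 'M[R]_n) (Hf r : Omega -> 'rV[R]_n -> R) (D : Omega -> 'rV[R]_n)
    (G : Omega -> 'M[R]_n) (Rad e : R) :
  (forall w, {within closure Theta, continuous (Hf w)}) ->
  (forall th, measurable_fun setT (fun w => Hf w th)) ->
  (forall j, measurable_fun setT (fun w => D w 0 j)) ->
  (forall i j, measurable_fun setT (fun w => G w i j)) ->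
  (forall w u, closure Theta (thstar + u *m A) ->
    Hf w (thstar + u *m A) - Hf w thstar = laq (D w) (G w) u + r w u) ->
  measurable [set w | exists u : 'rV[R]_n,
    [/\ closure Theta (thstar + u *m A), enorm u <= Rad & e < `|r w u|]].
Proof.
move=> cH mH mD mG hr.
pose S := [set u : 'rV[R]_n | closure Theta (thstar + u *m A) /\ enorm u <= Rad].
pose F w u := Hf w (thstar + u *m A) - Hf w thstar - laq (D w) (G w) u.
have rF w u : S u -> r w u = F w u.
  by move=> [Tu _]; rewrite /F hr// addrC addKr.
rewrite (_ : [set _ | _] = [set w | exists u, S u /\ e < `|F w u|]); last first.
  apply/seteqP; split=> w [u].
    by move=> [Tu uR eu]; exists u; rewrite -rF.
  by move=> [Su eu]; exists u; rewrite (rF w) //; case: Su.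
apply: (@measurable_exists_gt _ _ _ _ _ _ (@ratr_mx_dense R 1 n)) => [u Su|w u [Tu _] eu].
  apply: measurableT_comp => //; apply: measurable_funB.
    by apply: measurable_funB; exact: mH.
  exact: measurable_laq.
(* Half of the excess over [e] is allotted to the variation of [Hf], half to that of the quadratic
   part. *)
have e0 : 0 < (`|F w u| - e) / 2 by rewrite divr_gt0// subr_gt0.
have /subspace_continuousP/(_ _ Tu)/cvgrPdist_lt/(_ _ e0) := cH w.
rewrite near_withinE => nH.
have cphi : {for u, continuous (fun u : 'rV[R]_n => thstar + u *m A)}.
  apply: continuous_at_mx => i j.
  rewrite (_ : (fun _ => _) = (fun u : 'rV[R]_n => thstar i j + \sum_k u i k * A k j)).
    apply: continuous_atD; first exact: continuous_at_cst.
    apply: continuous_at_sum => k; apply: continuous_atM; last exact: continuous_at_cst.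
    exact: coord_continuous.
  by apply/funext => v; rewrite !mxE.
have nH' : \forall v \near u, closure Theta (thstar + v *m A) ->
    `|Hf w (thstar + u *m A) - Hf w (thstar + v *m A)| < (`|F w u| - e) / 2.
  exact: (cphi _ nH).
have nL : \forall v \near u,
    `|laq (D w) (G w) u - laq (D w) (G w) v| < (`|F w u| - e) / 2.
  have cL := @laq_continuous (D w) (G w) u.
  by have /(@cvgrPdist_lt _ _ _ (nbhs u))/(_ _ e0) := cL.
have nHL : \forall v \near u, (closure Theta (thstar + v *m A) ->
    `|Hf w (thstar + u *m A) - Hf w (thstar + v *m A)| < (`|F w u| - e) / 2) /\
    `|laq (D w) (G w) u - laq (D w) (G w) v| < (`|F w u| - e) / 2.
  exact: filterI nH' nL.
have [dl dl0 hdl] := near_ball_ex nHL.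
exists dl => // u' [Tu' _] /hdl[/= /(_ Tu') h1 h2].
have : `|F w u| - `|F w u'| < `|F w u| - e.
  apply: (le_lt_trans (lerB_dist _ _)).
  have -> : F w u - F w u' = (Hf w (thstar + u *m A) - Hf w (thstar + u' *m A))
    - (laq (D w) (G w) u - laq (D w) (G w) u') by rewrite /F; ring.
  by rewrite (splitr (`|F w u| - e)); apply: (le_lt_trans (ler_normB _ _)); rewrite ltrD.
by rewrite ltrD2l ltrN2.
Qed.

End FieldMeasurability.

(** * Asymptotics of the null and nonnull coordinates *)

Theorem theorem4
  (R : realType) (d : measure_display) (Omega : measurableType d)
  (P : probability Omega R)
  (* index set TT, subset of [0, oo), unbounded above *)
  (TT : set R) (hTT0 : forall T, TT T -> 0 <= T)
  (hTTub : forall M : R, exists T, TT T /\ M <= T)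
  (* parameter space *)
  (n : nat) (Theta : set 'rV[R]_n) (hopen : open Theta) (hbnd : bounded_set Theta)
  (thstar : 'rV[R]_n) (hthstar : Theta thstar)
  (* random field H_T *)
  (H : R -> Omega -> 'rV[R]_n -> R)
  (hHcont : forall T w, TT T -> {within closure Theta, continuous (H T w)})
  (hHmeas : forall T th, TT T -> measurable_fun setT (fun w => H T w th))
  (* penalty *)
  (xi : R -> Omega -> 'I_n -> R)
  (hxipos : forall T w j, TT T -> 0 < xi T w j)
  (hximeas : forall T j, TT T -> measurable_fun setT (fun w => xi T w j))
  (pen : R -> R) (hpen0 : pen 0 = 0) (hpenge0 : forall x, 0 <= pen x)
  (* penalized estimator *)
  (thhat : R -> Omega -> 'rV[R]_n)
  (hthhat_meas : forall T j, TT T -> measurable_fun setT (fun w => thhat T w 0 j))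
  (hthhat_in : forall T w, TT T -> closure Theta (thhat T w))
  (hthhat_max : forall T w th, TT T -> closure Theta th ->
     H T w th - penT xi pen T w th <= H T w (thhat T w) - penT xi pen T w (thhat T w))
  (* rate matrix a_T = diag(alpha_T) *)
  (alpha : R -> 'I_n -> R)
  (halpha_inv : forall T j, TT T -> alpha T j != 0)
  (halpha0 : lim_along TT (fun T => \big[Num.max/0]_j `|alpha T j|) 0)
  (q : R) (hq : 0 < q <= 1)
  (* [A2] *)
  (hA2 : forall x : R, x != 0 -> derivable pen x 1)
  (* [A5] *)
  (hA5 : exists lam : R, 0 < lam /\ (pen x / (`|x| `^ q)) @[x --> 0^'] --> lam)
  (* [A6] *)
  (hA6 : forall j, thstar 0 j = 0 ->
     cvg_prob P TT (fun T w => xi T w j `^ (- q^-1) / `|alpha T j|) (fun _ => 0))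
  (* [A10] LAQ *)
  (DeltaT : R -> Omega -> 'rV[R]_n) (GammaT : R -> Omega -> 'M[R]_n)
  (Delta : Omega -> 'rV[R]_n) (Gamma : Omega -> 'M[R]_n)
  (r : R -> Omega -> 'rV[R]_n -> R)
  (hDeltaT_meas : forall T i, TT T -> measurable_fun setT (fun w => DeltaT T w 0 i))
  (hGammaT_meas : forall T i k, TT T -> measurable_fun setT (fun w => GammaT T w i k))
  (hDelta_meas : forall i, measurable_fun setT (fun w => Delta w 0 i))
  (hGamma_meas : forall i k, measurable_fun setT (fun w => Gamma w i k))
  (hA10i : forall T w (u : 'rV[R]_n), TT T ->
     closure Theta (thstar + u *m diag_mx (\row_j alpha T j)) ->
     H T w (thstar + u *m diag_mx (\row_j alpha T j)) - H T w thstar =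
       (DeltaT T w *m u^T) 0 0 - 2^-1 * (u *m GammaT T w *m u^T) 0 0 + r T w u)
  (hA10ii : {ae P, forall w, posdef (Gamma w)})
  (hA10iii : cvg_dist P TT (fun T w => (DeltaT T w, GammaT T w))
                           (fun w => (Delta w, Gamma w)))
  (hA10iv : forall Rad : R, 0 < Rad -> forall e : R, 0 < e ->
     lim_along TT (fun T => fine (P [set w | exists u : 'rV[R]_n,
        [/\ closure Theta (thstar + u *m diag_mx (\row_j alpha T j)), enorm u <= Rad
          & e < `|r T w u|]])) 0)
  (* [A11] *)
  (beta : 'I_n -> R)
  (hA11 : forall j, thstar 0 j != 0 ->
     cvg_prob P TT (fun T w => xi T w j * alpha T j) (fun _ => beta j))
  (* tilde u_T = O_p(1) *)
  (htight : tight P TT (utilde thstar q xi alpha thhat)) :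
  let J0 := [set j : 'I_n | thstar 0 j == 0]%SET in
  let J1 := [set j : 'I_n | thstar 0 j != 0]%SET in
  let psi := \row_(j < n) (beta j * derive1 pen (thstar 0 j)) in
  cvg_prob P TT (fun T w => enorm_on J0 (utilde thstar q xi alpha thhat T w)) (fun _ => 0)
  /\
  cvg_dist P TT (fun T w => subrowJ J1 (utilde thstar q xi alpha thhat T w))
    (fun w => ((invmx (prinsubmx J1 (Gamma w))) *m (subrowJ J1 (Delta w) - subrowJ J1 psi)^T)^T).
Proof.
move=> J0 J1 psi.
have [q0 q1] : 0 < q /\ q <= 1 by case/andP: hq.
have [rho rho0 hrho] : exists2 rho, 0 < rho & forall t : 'rV[R]_n,
    (forall j, `|t 0 j - thstar 0 j| < rho) -> closure Theta t.
  have [rho rho0 hrho] := near_ball_ex (open_nbhs_nbhs (conj hopen hthstar)).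
  exists rho => // t ht; apply: subset_closure; apply: hrho; split => // i j.
  by rewrite (ord1 i) /ball/= distrC; exact: ht.
have [lam [lam0 hlam]] := hA5.
have [dlam dlam0 hdlam] := penalty_lower_bound q0 hpenge0 lam0 hlam.
have l20 : 0 < lam / 2 by rewrite divr_gt0.
pose ut T w := utilde thstar q xi alpha thhat T w.
have mut T j : TT T -> measurable_fun setT (fun w => ut T w 0 j).
  move=> TT_T; rewrite (_ : (fun _ => _) = (fun w => (thhat T w 0 j - thstar 0 j) *
      (if thstar 0 j == 0 then xi T w j `^ (- q^-1) else alpha T j)^-1)); last first.
    by apply/funext => w; rewrite /ut mxE.
  apply: measurable_funM; first by apply: measurable_funB => //; exact: hthhat_meas.
  apply: measurable_invr; case: eqP => // _.
  by apply: (measurableT_comp (@measurable_powR R (- q^-1))); exact: hximeas.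
have mX T (h : 'rV[R]_n * 'M[R]_n -> R) : TT T -> continuous h ->
    measurable_fun setT (h \o (fun w => (DeltaT T w, GammaT T w))).
  move=> TT_T ch; apply: measurable_continuous_mx2 => // i j; last exact: hGammaT_meas.
  by rewrite (ord1 i); exact: hDeltaT_meas.
have mZ (h : 'rV[R]_n * 'M[R]_n -> R) : continuous h ->
    measurable_fun setT (h \o (fun w => (Delta w, Gamma w))).
  move=> ch; apply: measurable_continuous_mx2 => // i j.
  by rewrite (ord1 i); exact: hDelta_meas.
(* A single continuous function dominates all entries of both components, so one tail bound controls
   [DeltaT] and [GammaT] together. *)
pose gn (z : 'rV[R]_n * 'M[R]_n) : R :=
  \sum_j `|z.1 0 j| + \sum_i \sum_j `|z.2 i j|.
have cgn : continuous gn.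
  move=> z; apply: (@continuous_atD R _ z (fun z : 'rV[R]_n * 'M[R]_n => \sum_j `|z.1 0 j|)
      (fun z : 'rV[R]_n * 'M[R]_n => \sum_i \sum_j `|z.2 i j|)).
    apply: continuous_at_sum => j; apply: continuous_at_norm.
    by apply: continuous_at_entry; exact: cvg_fst.
  apply: continuous_at_sum => i; apply: continuous_at_sum => j.
  by apply: continuous_at_norm; apply: continuous_at_entry; exact: cvg_snd.
have gn1 (z : 'rV[R]_n * 'M[R]_n) j : `|z.1 0 j| <= gn z.
  rewrite /gn (bigD1 j)//= -addrA lerDl addr_ge0 ?sumr_ge0// => i _.
  by rewrite sumr_ge0.
have gn2 (z : 'rV[R]_n * 'M[R]_n) i j : `|z.2 i j| <= gn z.
  rewrite /gn addrC (bigD1 i)//= (bigD1 j)//= -!addrA lerDl.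
  rewrite !addr_ge0 ?sumr_ge0// => k _.
  by rewrite sumr_ge0.
pose Abad j e T := if thstar 0 j == 0
  then [set w | e < `|xi T w j `^ (- q^-1) / `|alpha T j| - 0|]
  else [set w | e < `|xi T w j * alpha T j - beta j|].
pose bad K Rad e T : set Omega :=
  ([set w | K < enorm (ut T w)] `|` [set w | K < gn (DeltaT T w, GammaT T w)]) `|`
  ([set w | exists u : 'rV[R]_n,
        [/\ closure Theta (thstar + u *m diag_mx (\row_j alpha T j)), enorm u <= Rad
          & e < `|r T w u|]] `|` \big[setU/set0]_(j < n) Abad j e T).
(* [K] depends on [eps] alone and is fixed before [Rad] and [e], which are later chosen in terms of
   [K]. *)
have bad_small eps : 0 < eps -> exists2 K, 1 <= K & forall Rad e, 0 < Rad -> 0 < e ->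
    eventually_small P TT (bad K Rad e) eps.
  move=> eps0; have eps4 : 0 < eps / 2 / 2 by rewrite !divr_gt0.
  have eps2 : 0 < eps / 2 by rewrite divr_gt0.
  have [K1 hK1] := htight _ eps4.
  have [K2 K21 hK2] := cvg_dist_tail hA10iii cgn mX mZ eps4.
  exists (Num.max K1 K2); first by rewrite le_max K21 orbT.
  move=> Rad e Rad0 e0; rewrite (splitr eps); apply: eventually_smallU.
    rewrite (splitr (eps / 2)); apply: eventually_smallU.
      exists 0 => T TT_T _.
      have mE K : measurable [set w | K < enorm (ut T w)].
        apply: measurable_set_lt => //.
        rewrite (_ : (fun _ => _) = (fun w => enorm_on [set: 'I_n]%SET (ut T w))).
          by apply: measurable_enorm_on => j; exact: mut.
        by apply/funext => w; rewrite enormE.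
      split => //; rewrite -probability_lt//; apply: le_lt_trans (hK1 _ TT_T).
      apply: le_measure; rewrite ?inE//.
      by move=> w /=; apply: le_lt_trans; rewrite le_max lexx.
    by apply: hK2; rewrite le_max lexx orbT.
  rewrite (splitr (eps / 2)); apply: eventually_smallU.
    apply: lim_along_eventually_small => //; last exact: hA10iv.
    move=> T TT_T; apply: (@measurable_remainder_exceeds _ _ _ _ _ _ _ (H T) (r T)
        (DeltaT T) (GammaT T)) => //.
    - by move=> w; exact: hHcont.
    - by move=> th; exact: hHmeas.
    - by move=> j; exact: hDeltaT_meas.
    - by move=> i j; exact: hGammaT_meas.
    - by move=> w u Tu; exact: hA10i.
  apply: eventually_small_bigU => // j e' e'0.
  rewrite /Abad; case: (eqVneq (thstar 0 j) 0) => t0.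
    apply: lim_along_eventually_small => //; last exact: hA6.
    move=> T TT_T; apply: measurable_set_lt => //; apply: measurableT_comp => //.
    apply: measurable_funB => //; apply: measurable_funM => //.
    by apply: (measurableT_comp (@measurable_powR R (- q^-1))); exact: hximeas.
  apply: lim_along_eventually_small => //; last exact: hA11.
  move=> T TT_T; apply: measurable_set_lt => //; apply: measurableT_comp => //.
  by apply: measurable_funB => //; apply: measurable_funM => //; exact: hximeas.
have alpha_small e : 0 < e -> exists T0, forall T, TT T -> T0 <= T ->
    forall j, `|alpha T j| <= e.
  move=> e0; have [T0 hT0] := halpha0 e e0; exists T0 => T TT_T le_T j.
  apply: (le_trans (@le_bigmax _ _ _ 0 (fun j => `|alpha T j|) j)).
  apply: (le_trans (ler_norm _)); apply: ltW.
  by have := hT0 _ TT_T le_T; rewrite subr0.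
have good K Rad e T w : TT T -> ~ bad K Rad e T w ->
    [/\ (forall j, `|ut T w 0 j| <= K),
      (forall j, `|DeltaT T w 0 j| <= K) /\ (forall i j, `|GammaT T w i j| <= K),
      (forall u, closure Theta (thstar + u *m diag_mx (\row_j alpha T j)) ->
        enorm u <= Rad -> `|r T w u| <= e),
      (forall j, thstar 0 j = 0 -> xi T w j `^ (- q^-1) / `|alpha T j| <= e) &
      (forall j, thstar 0 j != 0 -> `|xi T w j * alpha T j - beta j| <= e)].
  move=> TT_T nb.
  have nA j : ~ Abad j e T w.
    by move=> Aj; apply: nb; right; right; rewrite (bigD1 j)//=; left.
  have ngn : gn (DeltaT T w, GammaT T w) <= K.
    by rewrite leNgt; apply/negP => h; apply: nb; left; right.
  split.
  - move=> j; apply: (le_trans (entry_le_enorm _ j)).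
    by rewrite leNgt; apply/negP => h; apply: nb; left; left.
  - by split=> [j|i j]; apply: le_trans ngn; [exact: gn1 (_, _) j|exact: gn2 (_, _) i j].
  - move=> u Tu uR; rewrite leNgt; apply/negP => h; apply: nb; right; left.
    by exists u.
  - move=> j t0; have := nA j; rewrite /Abad t0 eqxx/= subr0 => /negP.
    by rewrite -leNgt => /(le_trans (ler_norm _)).
  - move=> j t0; have := nA j; rewrite /Abad (negbTE t0)/= => /negP.
    by rewrite -leNgt.
split.
  move=> e0 e00 dl dl0.
  have [K K1 hK] := bad_small _ dl0.
  have K0 : 0 < K by exact: lt_le_trans K1.
  pose C0 := 2 + (n%:R * K + (n * n)%:R * K ^+ 2) * K.
  (* The norm is at most [n] times a bound on the coordinates; the added 1 covers [n = 0]. *)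
  pose eta := e0 / (n%:R + 1).
  have n1 : 0 < n%:R + 1 :> R by rewrite ltr_wpDl.
  have eta0 : 0 < eta by rewrite divr_gt0.
  have leta : 0 < lam / 2 * eta `^ q by rewrite mulr_gt0// powR_gt0.
  (* In order: [e] is below 1, points of the box are admissible, the lower bound on the penalty
     applies to the estimator, and [local_null] forces coordinates below [eta]. *)
  have [e ee [[e1 erho] [elam eC]]] : exists2 e, 0 < e & ((1 * e < 1 /\ K * e < rho) /\
      (K * e < dlam /\ C0 * e < lam / 2 * eta `^ q)).
    apply: near_right0_ex; apply: filterI; apply: filterI;
      exact: near_right0_mul_lt.
  rewrite mul1r in e1.
  have Rad0 : 0 < n%:R * K + 1 by rewrite ltr_wpDl// mulr_ge0// ltW.
  have [T1 hT1] := hK _ _ Rad0 ee; have [T2 hT2] := alpha_small _ ee.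
  exists (Num.max T1 T2) => T TT_T; rewrite ge_max => /andP[le1 le2].
  have [mB PB] := hT1 _ TT_T le1.
  rewrite subr0 ger0_norm ?fine_ge0//.
  have mS : measurable [set w | e0 < `|enorm_on J0 (ut T w) - 0|].
    apply: measurable_set_lt => //; apply: measurableT_comp => //.
    by apply: measurable_funB => //; apply: measurable_enorm_on => j; exact: mut.
  apply: le_lt_trans PB; apply: fine_le; rewrite ?fin_num_measure//.
  apply: le_measure; rewrite ?inE// => w /=; apply: contraPP => nb.
  apply/negP; rewrite -leNgt subr0 ger0_norm ?sqrtr_ge0//.
  have [gut [gD gG] gr g0 _] := good _ _ _ _ _ TT_T nb.
  apply: (@le_trans _ _ (n%:R * eta)); last first.
    by rewrite /eta mulrA ler_pdivrMr// mulrC ler_pM2l// lerDl.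
  apply: enorm_on_le; first exact: ltW.
  move=> j; rewrite inE => /eqP t0.
  have e01 : 0 < e <= 1 by rewrite ee ltW.
  have nK : n%:R * K <= n%:R * K + 1 by rewrite lerDl.
  rewrite mulrC in erho; rewrite mulrC in elam.
  have gut' j' : `|(thhat T w 0 j' - thstar 0 j') / (if thstar 0 j' == 0
      then xi T w j' `^ (- q^-1) else alpha T j')| <= K.
    by have := gut j'; rewrite /ut mxE.
  have := @local_null _ _ _ _ _ _ _ _ _ _ _ (xi T w) (alpha T) (thhat T w) _ _ _ (H T w)
    hrho hpen0 hpenge0 q0 K1 (lexx K) nK e01 erho
    (fun j => hxipos T w j TT_T) (fun j => halpha_inv T j TT_T) (hT2 _ TT_T le2)
    g0 gut' gD gG gr (fun t => hthhat_max T w t TT_T) (fun u => hA10i T w u TT_T)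
    _ _ j hdlam elam t0.
  move=> /le_lt_trans/(_ eC); rewrite ltr_pM2l// => lt_pow.
  rewrite leNgt; apply/negP => lt_eta; move: lt_pow; apply/negP; rewrite -leNgt.
  have -> : (thhat T w 0 j - thstar 0 j) / (if thstar 0 j == 0
      then xi T w j `^ (- q^-1) else alpha T j) = ut T w 0 j by rewrite /ut [in RHS]mxE.
  by apply: ge0_ler_powR; rewrite ?nnegrE// ltW.
pose Y w : 'rV[R]_#|J1| :=
  ((invmx (prinsubmx J1 (Gamma w))) *m (subrowJ J1 (Delta w) - subrowJ J1 psi)^T)^T.
have mY i : measurable_fun setT (fun w => Y w 0 i).
  rewrite (_ : (fun _ => _) = (fun w => \sum_k invmx (prinsubmx J1 (Gamma w)) i k *
      (Delta w 0 (enum_val k) - psi 0 (enum_val k)))); last first.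
    apply/funext => w; rewrite /Y mxE mxE; apply: eq_bigr => k _.
    by congr (_ * _); rewrite !mxE.
  apply: measurable_sum => k; apply: measurable_funM; last exact: measurable_funB.
  apply: measurable_invmx => a b.
  rewrite (_ : (fun _ => _) = (fun w => Gamma w (enum_val a) (enum_val b)))//.
  by apply/funext => w; rewrite mxE.
have mfut T (h : 'rV[R]_#|J1| -> R) : TT T -> continuous h ->
    measurable_fun setT (h \o (fun w => subrowJ J1 (ut T w))).
  move=> TT_T ch; apply: measurable_continuous_mx => // i j.
  rewrite (_ : (fun _ => _) = (fun w => ut T w 0 (enum_val j))); first exact: mut.
  by apply/funext => w; rewrite mxE.
have mfY (h : 'rV[R]_#|J1| -> R) : continuous h -> measurable_fun setT (h \o Y).
  by move=> ch; apply: measurable_continuous_mx => // i j; rewrite (ord1 i); exact: mY.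
apply: cvg_dist_upper => // f cf [M fM] eps eps0.
have M0 : 0 <= M by exact: le_trans (fM 0).
(* An event of probability below [pb] changes an expectation of size [M] by at most [eps / 4]; the
   added 1 covers [M = 0]. *)
pose pb := eps / 4 / (2 * M + 1).
have M1 : 0 < 2 * M + 1 by rewrite ltr_wpDl// mulr_ge0.
have pb0 : 0 < pb by rewrite !divr_gt0.
have Mpb p : p < pb -> 2 * M * p <= eps / 4.
  move=> /ltW pp; apply: (@le_trans _ _ ((2 * M + 1) * pb)); last first.
    by rewrite mulrC divfK// gt_eqF.
  have M20 : 0 <= 2 * M by rewrite mulr_ge0.
  by have h := ler_wpM2l M20 pp; clear -h pb0; lra.
have [N [mN PN0 hN]] := hA10ii.
have mcoerc : measurable_fun setT (fun w => coerc (Gamma w)).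
  apply: measurable_continuous_mx => //; exact: coerc_continuous.
(* Off the null set [N] the least eigenvalue is positive, so these events decrease to the empty set.
   The factor 2 is there because the cutoff reaches 1 only at twice its level. *)
pose F k := [set w | coerc (Gamma w) < 2 * k.+1%:R^-1] `\` N.
have mF k : measurable (F k).
  by apply: measurableD => //; exact: measurable_set_lt.
have [k Pk] : exists k, fine (P (F k)) < pb.
  apply: vanishing_prob => //.
    move=> k w [/= ck nN]; split => //=; apply: lt_le_trans ck _.
    by rewrite ler_pM2l// lef_pV2 ?posrE// ler_nat.
  apply/seteqP; split=> // w hw.
  have nNw : ~ N w by case: (hw 0%N I).
  have pw : posdef (Gamma w) by apply: contrapT => np; exact/nNw/hN.
  have c0 := posdef_coerc_gt0 pw.
  have [m hm] := inv_nat_small (divr_gt0 c0 (@ltr0n R 2)).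
  have [/= + _] := hw m I; rewrite ltNge; apply/negP; rewrite negbK.
  by rewrite mulrC -ler_pdivlMr// ltW.
pose c := k.+1%:R^-1 : R.
have c0 : 0 < c by rewrite invr_gt0.
pose B' := F k `|` N.
have mB' : measurable B' by exact: measurableU.
have PB' : fine (P B') < pb.
  rewrite -probability_lt//; apply: (le_lt_trans (measureU2 P (mF k) mN)).
  by rewrite [X in (_ + X < _)%E](_ : _ = 0%E)// adde0 probability_lt.
pose chi (z : 'rV[R]_n * 'M[R]_n) := clamp01 (coerc z.2 / c - 1).
(* Replacing [f] by its bound [M] where the cutoff is not 1 preserves upper bounds only, which is
   why the one-sided criterion is used. *)
pose Phi z := chi z * f (laq_sol J1 psi z) + (1 - chi z) * M.
have chi01 z : 0 <= chi z /\ chi z <= 1 by exact/andP/clamp01_itv.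
have chi_eq0 z : coerc z.2 <= c -> chi z = 0.
  by move=> zc; apply: clamp01_eq0; rewrite subr_le0 ler_pdivrMr// mul1r.
have chi_eq1 z : 2 * c <= coerc z.2 -> chi z = 1.
  by move=> zc; apply: clamp01_eq1; rewrite lerBrDr ler_pdivlMr.
have PhiM z : `|Phi z| <= M.
  have [c0' c1'] := chi01 z; have := fM (laq_sol J1 psi z).
  rewrite !ler_norml => /andP[f1 f2]; rewrite /Phi.
  by clear -M0 c0' c1' f1 f2; apply/andP; split; nra.
have ccoerc z : {for z, continuous (fun z : 'rV[R]_n * 'M[R]_n => coerc z.2)}.
  apply: (@continuous_comp _ _ _ snd (@coerc R n)); first exact: cvg_snd.
  exact: coerc_continuous.
have cPhi : continuous Phi.
  (* Below [c] the function is locally constant; from [c] on, coercivity holds with constant [c / 2]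
     and the maximizer is continuous. *)
  move=> z; have [zc|zc] := ltP (coerc z.2) c.
    apply/(@cvgrPdist_lt _ _ _ (nbhs z)) => e e0.
    have czz := ccoerc z.
    have c1 : 0 < c - coerc z.2 by rewrite subr_gt0.
    have nz : \forall y \near z, `|coerc z.2 - coerc y.2| < c - coerc z.2.
      by have /(@cvgrPdist_lt _ _ _ (nbhs z))/(_ _ c1) := czz.
    apply: filterS nz => y; rewrite ltr_norml => /andP[h _].
    have yc : coerc y.2 < c by clear -h; lra.
    by rewrite /Phi !chi_eq0 ?ltW// !mul0r subrr normr0.
  have c20 : 0 < c / 2 by rewrite divr_gt0.
  have c2z : c / 2 < coerc z.2.
    by apply: lt_le_trans zc; rewrite ltr_pdivrMr// ltr_pMr// ltr1n.
  have d0 := coercive_det J1 c20 (coerc_coercive c2z).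
  have cchi : {for z, continuous chi}.
    apply: (@continuous_at_clamp01 R _ z (fun z : 'rV[R]_n * 'M[R]_n => coerc z.2 / c - 1)).
    apply: continuous_atB; last exact: continuous_at_cst.
    by apply: continuous_atM; [exact: ccoerc|exact: continuous_at_cst].
  apply: (@continuous_atD R _ z (fun z => chi z * f (laq_sol J1 psi z))
    (fun z => (1 - chi z) * M)).
    apply: continuous_atM => //.
    apply: (@continuous_comp _ _ _ (laq_sol J1 psi) f); last exact: cf.
    exact: laq_sol_continuous.
  apply: continuous_atM; last exact: continuous_at_cst.
  by apply: continuous_atB => //; exact: continuous_at_cst.
have [K K1 hK] := bad_small _ pb0.
have K0 : 0 < K by exact: lt_le_trans K1.
have eps4 : 0 < eps / 4 by rewrite divr_gt0.
have [dl dl0 hdl] := @uniformly_continuous_box R _ f K (eps / 4) cf eps4.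
pose C0 := 2 + (n%:R * K + (n * n)%:R * K ^+ 2) * K.
pose Bp := \sum_j `|psi 0 j|.
(* The box of size [K2] contains both the rescaled estimator and the quadratic maximizer bounded by
   [laq_sol_bound]. *)
pose K2 := K + (n%:R * ((K + Bp) / c) ^+ 2 + 1).
have nge0 : 0 <= n%:R :> R by [].
have Kh0 : 0 <= n%:R * ((K + Bp) / c) ^+ 2 by rewrite mulr_ge0// sqr_ge0.
have KK2 : K <= K2 by rewrite lerDl addr_ge0.
have K20 : 0 < K2 by exact: lt_le_trans KK2.
have cdl : 0 < c * dl ^+ 2 by rewrite mulr_gt0// exprn_gt0.
(* With this choice the terms in [C0 * e] and in [err] of [local_nonnull] each take at most half of
   [c * dl ^+ 2]. *)
pose err := c * dl ^+ 2 / (8 * (n%:R + 1)).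
have err0 : 0 < err by rewrite divr_gt0// mulr_gt0// ltr_wpDl.
have errE : 8 * (n%:R + 1) * err = c * dl ^+ 2.
  by rewrite mulrC divfK// gt_eqF// mulr_gt0// ltr_wpDl.
have [e ee [[e1 erho] [eC hpl]]] : exists2 e, 0 < e & ((1 * e < 1 /\ K2 * e < rho) /\
    (C0 * e < c * dl ^+ 2 / 4 /\ forall j, thstar 0 j != 0 ->
      forall x a t, 0 < x -> `|a| <= e -> `|t| <= K2 -> `|x * a - beta j| <= e ->
      `|x * (pen (thstar 0 j + t * a) - pen (thstar 0 j))
         - beta j * derive1 pen (thstar 0 j) * t| <= err)).
  apply: near_right0_ex; apply: filterI; apply: filterI;
    [exact: near_right0_mul_lt|exact: near_right0_mul_lt| |].
    by apply: near_right0_mul_lt; rewrite divr_gt0.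
  exact: (@penalty_linearization_all R n pen (fun j => thstar 0 j) beta).
rewrite mul1r in e1.
have Rad0 : 0 < n%:R * K2 + 1 by rewrite ltr_wpDl// mulr_ge0// ltW.
have [T1 hT1] := hK _ _ Rad0 ee; have [T2 hT2] := alpha_small _ ee.
have [T3 hT3] := hA10iii Phi cPhi (ex_intro _ M PhiM) _ eps4.
exists (Num.max T1 (Num.max T2 T3)) => T TT_T; rewrite !ge_max => /and3P[le1 le2 le3].
have [mB PB] := hT1 _ TT_T le1.
(* On the bad event both sides differ by at most [2 * M]; where the least eigenvalue is at most [c],
   [Phi] equals [M]; elsewhere the estimator is [dl]-close to the maximizer. *)
have upper w : f (subrowJ J1 (ut T w)) <= Phi (DeltaT T w, GammaT T w) + eps / 4
    + 2 * M * \1_(bad K (n%:R * K2 + 1) e T) w.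
  set z := (DeltaT T w, GammaT T w).
  have := PhiM z; have := fM (subrowJ J1 (ut T w)).
  rewrite !ler_norml => /andP[_ fu] /andP[Phil _].
  rewrite indicE; case: (boolP (w \in _)) => [_|/negP].
    by clear -fu Phil eps4; rewrite mulr1; lra.
  rewrite inE => nb; rewrite mulr0 addr0.
  have [gut [gD gG] gr g0 g1] := good _ _ _ _ _ TT_T nb.
  have [chi0 chi1] := chi01 z.
  have [zc|zc] := leP (coerc z.2) c; first by rewrite /Phi (chi_eq0 z zc); clear -fu eps4; lra.
  have Gc : coercive (GammaT T w) c := coerc_coercive zc.
  have hsol i : `|laq_sol J1 psi z 0 i| <= K2.
    apply: (@le_trans _ _ (n%:R * ((K + Bp) / c) ^+ 2 + 1)); last by rewrite lerDr ltW.
    apply: laq_sol_bound => // j; apply: (le_trans (ler_normB _ _)); rewrite lerD//.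
    by rewrite /Bp (bigD1 j)//= lerDl sumr_ge0.
  have e01 : 0 < e <= 1 by rewrite ee ltW.
  have nK : n%:R * K2 <= n%:R * K2 + 1 by rewrite lerDl.
  have erho' : e * K2 < rho by rewrite mulrC.
  have gut' j' : `|(thhat T w 0 j' - thstar 0 j') / (if thstar 0 j' == 0
      then xi T w j' `^ (- q^-1) else alpha T j')| <= K.
    by have := gut j'; rewrite /ut mxE.
  have herr j t : thstar 0 j != 0 -> `|t| <= K2 ->
      `|xi T w j * (pen (thstar 0 j + t * alpha T j) - pen (thstar 0 j)) - psi 0 j * t|
      <= err.
    move=> t0 tK; rewrite mxE; apply: hpl => //; first exact: hxipos.
      exact: hT2.
    exact: g1.
  have := @local_nonnull _ _ _ _ _ _ _ _ _ _ _ (xi T w) (alpha T) (thhat T w) _ _ _ (H T w)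
    hrho hpen0 hpenge0 K1 KK2 nK e01 erho'
    (fun j => hxipos T w j TT_T) (fun j => halpha_inv T j TT_T) (hT2 _ TT_T le2)
    g0 gut' gD gG gr (fun t => hthhat_max T w t TT_T) (fun u => hA10i T w u TT_T)
    psi err c c0 Gc hsol herr (ltW err0).
  rewrite -/J1 -/C0 -/z => key.
  have close i : `|subrowJ J1 (ut T w) 0 i - laq_sol J1 psi z 0 i| < dl.
    have uE : subrowJ J1 (ut T w) 0 i =
        ((\row_j ((thhat T w 0 j - thstar 0 j) / alpha T j)) *m (selmx J1)^T) 0 i.
      rewrite selmx_mulr !mxE /atilde.
      by have := enum_valP i; rewrite inE => /negbTE ->.
    have : c * (subrowJ J1 (ut T w) 0 i - laq_sol J1 psi z 0 i) ^+ 2 < c * dl ^+ 2.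
      apply: (@le_lt_trans _ _ (2 * (C0 * e + 2 * n%:R * err))).
        apply: le_trans key; rewrite ler_pM2l// uE [leRHS](bigD1 i)//= lerDl.
        by apply: sumr_ge0 => i' _; exact: sqr_ge0.
      by clear -eC errE err0; lra.
    rewrite ltr_pM2l// -(real_normK (num_real (_ - _))) ltr_pXn2r// nnegrE//.
    exact: ltW.
  have utK i : `|subrowJ J1 (ut T w) 0 i| <= K by rewrite mxE.
  have := hdl _ _ utK close; rewrite ltr_norml => /andP[_ fh].
  have := ler_wpM2l chi0 (ltW fh); rewrite /Phi => h1.
  have h2 : chi z * (eps / 4) <= eps / 4 by rewrite ler_piMl// ltW.
  have h3 : (1 - chi z) * f (subrowJ J1 (ut T w)) <= (1 - chi z) * M.
    by apply: ler_wpM2l => //; rewrite subr_ge0.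
  by rewrite mulrBr in h1; clear -h1 h2 h3; lra.
(* For the limit, [Phi] coincides with [f] at the claimed limit variable outside [B'], as the cutoff
   equals 1 there and the matrix is positive definite. *)
have lower w : Phi (Delta w, Gamma w) <= f (Y w) + 0 + 2 * M * \1_B' w.
  set z := (Delta w, Gamma w).
  have := PhiM z; have := fM (Y w); rewrite !ler_norml => /andP[fl _] /andP[_ Phiu].
  rewrite addr0 indicE; case: (boolP (w \in _)) => [_|/negP].
    by clear -fl Phiu; rewrite mulr1; lra.
  rewrite inE => nB; rewrite mulr0 addr0.
  have nNw : ~ N w by move=> Nw; apply: nB; right.
  have pw : posdef (Gamma w) by apply: contrapT => np; exact/nNw/hN.
  have zc : 2 * c <= coerc (Gamma w).
    by rewrite leNgt; apply/negP => h; apply: nB; left.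
  rewrite /Phi chi_eq1// subrr mul0r addr0 mul1r.
  by rewrite laq_sol_invmx.
have E1 := expectation_le P (mfut T f TT_T cf) (mX T Phi TT_T cPhi) mB
  (fun w => fM (subrowJ J1 (ut T w))) (fun w => PhiM (DeltaT T w, GammaT T w)) upper.
have E2 := expectation_le P (mZ Phi cPhi) (mfY f cf) mB'
  (fun w => PhiM (Delta w, Gamma w)) (fun w => fM (Y w)) lower.
have := hT3 _ TT_T le3; rewrite ltr_norml => /andP[_ E3].
exact: (ler_eps_chain E1 E2 E3 (Mpb _ PB) (Mpb _ PB')).
Qed.
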